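(* Let $\varepsilon>0$, let $\mathcal{M}$ be a locally finite subset of the (real) Hilbert space $\ell_2$, equipped with the metric induced by the norm of $\ell_2$, and let $X$ be an arbitrary infinite-dimensional real Banach space. Then there exists a $(1+\varepsilon)$-bilipschitz embedding of $\mathcal{M}$ into $X$.
   Context: All normed spaces are over $\mathbb{R}$. A metric space is locally finite if each ball of finite radius in it contains finitely many elements. A map $F:(\mathcal{M},d_{\mathcal{M}})\to(\mathcal{L},d_{\mathcal{L}})$ between metric spaces is a bilipschitz embedding if there are constants $C_1,C_2>0$ with $C_1d_{\mathcal{M}}(u,v)\le d_{\mathcal{L}}(F(u),F(v))\le C_2d_{\mathcal{M}}(u,v)$ for all $u,v\in\mathcal{M}$. Its distortion is $\mathrm{Lip}(F)\cdot\mathrm{Lip}(F^{-1}|_{F(\mathcal{M})})$, where $\mathrm{Lip}(\cdot)$ is the Lipschitz constant. For $C\in[1,\infty)$, a bilipschitz embedding is called $C$-bilipschitz if its distortion does not exceed $C$. *)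

(* Defs.v *)
From HB Require Import structures.
From mathcomp Require Import all_boot all_order all_algebra.
From mathcomp Require Import all_classical all_reals all_analysis.
From mathcomp Require Import ring lra.

Set Implicit Arguments.
Unset Strict Implicit.
Unset Printing Implicit Defensive.

Import Order.TTheory GRing.Theory Num.Theory.
Import numFieldNormedType.Exports.

Local Open Scope classical_set_scope.
Local Open Scope ring_scope.

Section square_summable.
Variable R : realType.
Implicit Types x y : R^nat.

Definition square_series x : R^nat := [series x n ^+ 2]_n.

Definition square_summable : {pred R^nat} :=
  mem [set x | cvgn (square_series x)].

Lemma square_summableP x :
  reflect (cvgn (square_series x)) (x \in square_summable).
Proof. by apply: (iffP idP) => [/set_mem|/mem_set]. Qed.

Lemma square_series_ge0 x n : 0 <= square_series x n.
Proof. by apply: sumr_ge0 => i _; exact: sqr_ge0. Qed.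

Lemma nondecreasing_square_series x : nondecreasing_seq (square_series x).
Proof.
apply/nondecreasing_seqP => n.
by rewrite /square_series /series /= big_nat_recr//= lerDl sqr_ge0.
Qed.

Lemma square_series_le_lim x n : cvgn (square_series x) ->
  square_series x n <= limn (square_series x).
Proof.
move=> cx; apply: nondecreasing_cvgn_le => //.
exact: nondecreasing_square_series.
Qed.

Lemma lim_square_series_ge0 x : cvgn (square_series x) ->
  0 <= limn (square_series x).
Proof.
by move=> cx; exact: le_trans (square_series_ge0 x 0) (square_series_le_lim 0 cx).
Qed.

Lemma square_series_bounded x (M : R) : (forall n, square_series x n <= M) ->
  cvgn (square_series x) /\ limn (square_series x) <= M.
Proof.
move=> xM; have cx : cvgn (square_series x).
  apply: nondecreasing_is_cvgn; first exact: nondecreasing_square_series.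
  by exists M => _ [n _ <-].
by split=> //; apply: limr_le => //; exact: nearW.
Qed.

Lemma square_seriesZ a x :
  square_series (a *: x) = (a ^+ 2) *: square_series x.
Proof.
apply/funext => n; rewrite -[RHS]/(a ^+ 2 * square_series x n).
rewrite /square_series /series /= mulr_sumr; apply: eq_bigr => i _.
by rewrite -[(a *: x) i]/(a * x i) exprMn.
Qed.

Lemma lim_square_seriesZ a x : cvgn (square_series x) ->
  cvgn (square_series (a *: x)) /\
  limn (square_series (a *: x)) = a ^+ 2 * limn (square_series x).
Proof.
move=> cx; rewrite square_seriesZ; split; first exact: is_cvgZr.
by rewrite limZr.
Qed.

Lemma square_series_addr_le x y (t : R) n : 0 < t ->
  square_series (x + y) n <=
  (1 + t) * square_series x n + (1 + t^-1) * square_series y n.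
Proof.
move=> t0; rewrite /square_series /series /= !mulr_sumr -big_split /=.
apply: ler_sum => i _; rewrite -[(x + y) i]/(x i + y i).
set a := x i; set b := y i; rewrite -subr_ge0.
have -> : (1 + t) * a ^+ 2 + (1 + t^-1) * b ^+ 2 - (a + b) ^+ 2 =
    t^-1 * (t * a - b) ^+ 2 by field; rewrite gt_eqF.
by rewrite mulr_ge0 ?invr_ge0 ?sqr_ge0 ?(ltW t0).
Qed.

Lemma lim_square_seriesD_le x y (t : R) : 0 < t ->
  cvgn (square_series x) -> cvgn (square_series y) ->
  cvgn (square_series (x + y)) /\
  limn (square_series (x + y)) <=
    (1 + t) * limn (square_series x) + (1 + t^-1) * limn (square_series y).
Proof.
move=> t0 cx cy; apply: square_series_bounded => n.
apply: (le_trans (square_series_addr_le x y n t0)); apply: lerD.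
  by rewrite ler_pM2l ?square_series_le_lim// addr_gt0.
by rewrite ler_pM2l ?square_series_le_lim// addr_gt0 ?invr_gt0.
Qed.

Lemma square_summable_submod_closed : submod_closed square_summable.
Proof.
split=> [|a x y /square_summableP cx /square_summableP cy].
  have h n : square_series 0 n <= 0.
    by rewrite /square_series /series /= big1// => i _; rewrite expr0n.
  by apply/square_summableP; have [] := square_series_bounded h.
apply/square_summableP; have [cax _] := lim_square_seriesZ a cx.
by have [] := lim_square_seriesD_le ltr01 cax cy.
Qed.

HB.instance Definition _ :=
  GRing.isSubmodClosed.Build R (R^nat) square_summable
    square_summable_submod_closed.

Record ell2 := Ell2 {
  ell2_seq :> R^nat ;
  _ : ell2_seq \in square_summable }.

HB.instance Definition _ := [isSub for ell2_seq].
HB.instance Definition _ := [Choice of ell2 by <:].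
HB.instance Definition _ := [SubChoice_isSubLmodule of ell2 by <:].

Definition ell2_norm (x : ell2) : R := Num.sqrt (limn (square_series x)).

Lemma ell2_cvg (x : ell2) : cvgn (square_series x).
Proof. by apply/square_summableP; exact: valP. Qed.
Arguments ell2_cvg : clear implicits.

Lemma sqr_ell2_norm (x : ell2) : ell2_norm x ^+ 2 = limn (square_series x).
Proof. by rewrite sqr_sqrtr// lim_square_series_ge0//; exact: ell2_cvg. Qed.

Lemma ell2_norm0_eq0 (x : ell2) : ell2_norm x = 0 -> x = 0.
Proof.
move=> x0; apply/val_inj/funext => n /=.
have := square_series_le_lim n.+1 (ell2_cvg x).
rewrite -sqr_ell2_norm x0 expr0n /square_series /series /= big_nat_recr//=.
move=> h; apply/eqP; rewrite -sqrf_eq0 eq_le sqr_ge0 andbT.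
apply: le_trans h; rewrite lerDr; exact: square_series_ge0.
Qed.

Lemma ell2_normZ (a : R) (x : ell2) : ell2_norm (a *: x) = `|a| * ell2_norm x.
Proof.
rewrite /ell2_norm.
have [_ /= ->] := lim_square_seriesZ a (ell2_cvg x).
by rewrite sqrtrM ?sqr_ge0// sqrtr_sqr.
Qed.

Lemma ell2_normD (x y : ell2) :
  ell2_norm (x + y) <= ell2_norm x + ell2_norm y.
Proof.
have [x0|x0] := eqVneq (ell2_norm x) 0.
  by rewrite (ell2_norm0_eq0 x0) add0r lerDr sqrtr_ge0.
have [y0|y0] := eqVneq (ell2_norm y) 0.
  by rewrite (ell2_norm0_eq0 y0) addr0 lerDl sqrtr_ge0.
have a0 : 0 < ell2_norm x by rewrite lt_def x0 sqrtr_ge0.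
have b0 : 0 < ell2_norm y by rewrite lt_def y0 sqrtr_ge0.
rewrite -(@ler_pXn2r _ 2)// ?nnegrE ?addr_ge0 ?sqrtr_ge0//.
rewrite [in leLHS]sqr_ell2_norm.
have [_ /=] := lim_square_seriesD_le (divr_gt0 b0 a0) (ell2_cvg x) (ell2_cvg y).
rewrite -!sqr_ell2_norm => /le_trans; apply.
by rewrite le_eqVlt; apply/orP; left; apply/eqP; field; rewrite x0 y0.
Qed.

HB.instance Definition _ :=
  Lmodule_isNormed.Build R ell2 ell2_normD ell2_normZ ell2_norm0_eq0.

End square_summable.
Arguments ell2_cvg {R} x.

Lemma ell2_normE (R : realType) (x : ell2 R) :
  `|x| = Num.sqrt (limn [series (x : R^nat) n ^+ 2]_n).
Proof. by []. Qed.

Definition infinite_dimensional (R : realType) (X : lmodType R) : Prop :=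
  ~ exists (n : nat) (b : 'I_n -> X),
      forall x, exists c : 'I_n -> R, x = \sum_(i < n) c i *: b i.

Section bilipschitz.
Variables (R : realType) (V W : normedModType R).
Implicit Types (M : set V) (F : V -> W).

Definition locally_finite M : Prop :=
  forall x (r : R), M x -> finite_set (M `&` ball x r).

Definition bilipschitz_embedding M F : Prop :=
  exists C1 C2 : R, [/\ 0 < C1, 0 < C2 &
    forall u v, M u -> M v ->
      C1 * `|u - v| <= `|F u - F v| /\ `|F u - F v| <= C2 * `|u - v|].

End bilipschitz.

(* The least nonnegative Lipschitz constant of [F] on [M]; it is [+oo] if [F]
   is not Lipschitz on [M], and 0 if [M] has at most one point. *)
Definition lipschitz_constant (R : realType) (V W : normedModType R)
    (M : set V) (F : V -> W) : \bar R :=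
  ereal_inf (EFin @` [set k | 0 <= k /\ k.-lipschitz_M F]).

(* [pinv M F] is the inverse of [F] restricted to [M], defined on [F @` M]. *)
Definition distortion (R : realType) (V W : normedModType R)
    (M : set V) (F : V -> W) : \bar R :=
  (lipschitz_constant M F * lipschitz_constant (F @` M) (pinv M F))%E.

(* Only the restriction of [F] to [M] matters. *)
Definition C_bilipschitz (R : realType) (V W : normedModType R) (C : R)
    (M : set V) (F : V -> W) : Prop :=
  bilipschitz_embedding M F /\ (distortion M F <= C%:E)%E.

(* Main.v *)
Require Import Defs.
From mathcomp Require Import all_boot all_order all_algebra.
From mathcomp Require Import all_classical all_reals all_analysis.
From mathcomp Require Import perm ring lra.

Set Implicit Arguments.
Unset Strict Implicit.
Unset Printing Implicit Defensive.

Import Order.TTheory GRing.Theory Num.Theory.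
Import numFieldNormedType.Exports.

Local Open Scope classical_set_scope.
Local Open Scope ring_scope.

(** The embedding glues finite-dimensional almost isometric embeddings.  Suppose
    T_0, T_1, ... are linear maps from Euclidean spaces of prescribed dimensions to X
    such that the norm of (1 - s) T_i x + s T_(i+1) y is, up to a small error, a number
    N_i(s) independent of the unit vectors x and y.  Then, P_i being the truncation of
    a sequence to its first coordinates,
    V_(i + s) x = ((1 - s) T_i P_i x + s T_(i+1) P_(i+1) x) / N_i(s) is almost isometric
    on vectors well approximated by their truncations, and it is Lipschitz in the time
    i + s.  The map F x = V_(kappa ln (1 + |x|)) x works because
    F v - F u = V_(t v) (v - u) + (V_(t v) - V_(t u)) u, where
    |t v - t u| |u| <= kappa |v - u| if |u| <= |v|.

    The maps T_i come from Dvoretzky's theorem followed by Milman's: a convex Lipschitz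
    function on a high-dimensional Euclidean space is almost constant on the sphere of
    some almost isometrically embedded R^k.  Both are obtained by embedding R^k with a
    matrix whose rows are independent random points of the sphere.  The law of the
    points is almost rotation invariant: it is uniform on a net of minimal cardinality,
    which Hall's theorem matches with its image under any isometry.  The variance is
    controlled by the Efron-Stein inequality.  For Dvoretzky's theorem the mean is made
    large compared with the standard deviation by repeating many times the vectors of a
    Dvoretzky-Rogers system. *)

(** * Euclidean geometry of real functions on a finite type *)

Section Euclidean.
Variables (R : realType) (I : finType).
Implicit Types x y z a b : I -> R.

Definition dot x y : R := \sum_i x i * y i.
Definition nrm x : R := Num.sqrt (dot x x).

Lemma dotC x y : dot x y = dot y x.
Proof. by apply: eq_bigr => i _; rewrite mulrC. Qed.

Lemma dotDl x y z : dot (x + y) z = dot x z + dot y z.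
Proof. by rewrite -big_split; apply: eq_bigr => i _; exact: mulrDl. Qed.

Lemma dotZl (t : R) x z : dot (t *: x) z = t * dot x z.
Proof. by rewrite mulr_sumr; apply: eq_bigr => i _; rewrite mulrA. Qed.

Lemma dotNl x z : dot (- x) z = - dot x z.
Proof. by rewrite -scaleN1r dotZl mulN1r. Qed.

Lemma dotBl x y z : dot (x - y) z = dot x z - dot y z.
Proof. by rewrite dotDl dotNl. Qed.

Lemma dotDr x y z : dot z (x + y) = dot z x + dot z y.
Proof. by rewrite dotC dotDl !(dotC z). Qed.

Lemma dotZr (t : R) x z : dot z (t *: x) = t * dot z x.
Proof. by rewrite dotC dotZl dotC. Qed.

Lemma dotNr x z : dot z (- x) = - dot z x.
Proof. by rewrite dotC dotNl dotC. Qed.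

Lemma dotBr x y z : dot z (x - y) = dot z x - dot z y.
Proof. by rewrite dotDr dotNr. Qed.

Lemma dot0l x : dot 0 x = 0.
Proof. by apply: big1 => i _; rewrite mul0r. Qed.

Lemma dot_ge0 x : 0 <= dot x x.
Proof. by apply: sumr_ge0 => i _; rewrite -expr2 sqr_ge0. Qed.

Lemma dot_eq0 x : dot x x = 0 -> x = 0.
Proof.
move=> /eqP; rewrite psumr_eq0 => [/allP h|i _]; last by rewrite -expr2 sqr_ge0.
apply/funext => i; apply/eqP.
by have := h i (mem_index_enum i); rewrite /= -expr2 sqrf_eq0.
Qed.

Lemma nrm_ge0 x : 0 <= nrm x. Proof. exact: sqrtr_ge0. Qed.

Lemma sqr_nrm x : nrm x ^+ 2 = dot x x.
Proof. by rewrite sqr_sqrtr// dot_ge0. Qed.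

Lemma nrm_eq0 x : nrm x = 0 -> x = 0.
Proof. by move=> h; apply: dot_eq0; rewrite -sqr_nrm h expr0n. Qed.

Lemma nrm_gt0 x : x != 0 -> 0 < nrm x.
Proof. by move=> h; rewrite lt_def nrm_ge0 andbT; apply: contra_neq h => /nrm_eq0. Qed.

Lemma nrm0 : nrm (0 : I -> R) = 0.
Proof. by rewrite /nrm dot0l sqrtr0. Qed.

Lemma nrmZ (t : R) x : nrm (t *: x) = `|t| * nrm x.
Proof. by rewrite /nrm dotZl dotZr mulrA -expr2 sqrtrM ?sqr_ge0// sqrtr_sqr. Qed.

Lemma nrmN x : nrm (- x) = nrm x.
Proof. by rewrite -scaleN1r nrmZ normrN1 mul1r. Qed.

Lemma nrmBC x y : nrm (x - y) = nrm (y - x).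
Proof. by rewrite -nrmN opprB. Qed.

(** Cauchy-Schwarz, by expanding the squared norm of [nrm y *: x - nrm x *: y]. *)
Lemma dot_le x y : dot x y <= nrm x * nrm y.
Proof.
have [->|x0] := eqVneq x 0; first by rewrite dot0l nrm0 mul0r.
have [->|y0] := eqVneq y 0; first by rewrite dotC dot0l nrm0 mulr0.
have px := nrm_gt0 x0; have py := nrm_gt0 y0.
have := dot_ge0 (nrm y *: x - nrm x *: y).
rewrite dotBl !dotBr !dotZl !dotZr (dotC y x) -!sqr_nrm => h.
have {h} : 0 <= (2 * (nrm x * nrm y)) * (nrm x * nrm y - dot x y) by lra.
by rewrite pmulr_rge0 ?subr_ge0// !mulr_gt0.
Qed.

Lemma norm_dot_le x y : `|dot x y| <= nrm x * nrm y.
Proof.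
rewrite ler_norml dot_le andbT lerNl -dotNl; apply: le_trans (dot_le _ _) _.
by rewrite nrmN.
Qed.

Lemma nrmD x y : nrm (x + y) <= nrm x + nrm y.
Proof.
rewrite -(@ler_pXn2r _ 2)// ?nnegrE ?addr_ge0 ?nrm_ge0//.
rewrite sqr_nrm dotDl !dotDr (dotC y x) -!sqr_nrm.
have := dot_le x y; lra.
Qed.

Lemma nrmB_norm x y : `|nrm x - nrm y| <= nrm (x - y).
Proof.
have h u v : nrm u - nrm v <= nrm (u - v).
  by rewrite lerBlDr; apply: le_trans (nrmD _ _); rewrite subrK.
by rewrite ler_norml h andbT lerNl opprB nrmBC h.
Qed.

Lemma coord_le_nrm x i : `|x i| <= nrm x.
Proof.
rewrite -(@ler_pXn2r _ 2)// ?nnegrE ?normr_ge0 ?nrm_ge0// sqr_nrm.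
rewrite -normrX ger0_norm ?sqr_ge0// /dot (bigD1 i)//= expr2 lerDl.
by apply: sumr_ge0 => j _; rewrite -expr2 sqr_ge0.
Qed.

Lemma nrm_le_bound x (t : R) : 0 <= t -> (forall i, `|x i| <= t) ->
  nrm x <= t * Num.sqrt #|I|%:R.
Proof.
move=> t0 h; rewrite -(@ler_pXn2r _ 2)// ?nnegrE ?mulr_ge0 ?sqrtr_ge0 ?nrm_ge0//.
rewrite sqr_nrm exprMn sqr_sqrtr// mulr_natr -sumr_const.
apply: ler_sum => i _; rewrite -expr2 -real_normK ?num_real//.
by rewrite ler_pXn2r ?nnegrE.
Qed.

Definition unitv (i : I) : I -> R := fun j => (j == i)%:R.

Lemma dot_unitv x i : dot x (unitv i) = x i.
Proof.
rewrite /dot (bigD1 i)//= /unitv eqxx mulr1 big1 ?addr0// => j /negPf ->.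
by rewrite mulr0.
Qed.

Lemma nrm_unitv i : nrm (unitv i) = 1.
Proof. by rewrite /nrm dot_unitv /unitv eqxx sqrtr1. Qed.

Lemma nrm_normalize x : x != 0 -> nrm ((nrm x)^-1 *: x) = 1.
Proof.
move=> x0; have h := nrm_gt0 x0.
by rewrite nrmZ ger0_norm ?invr_ge0 ?nrm_ge0// mulVf// gt_eqF.
Qed.

Lemma nrm_normalizeK x : x = nrm x *: ((nrm x)^-1 *: x).
Proof.
have [->|x0] := eqVneq x 0; first by rewrite !scaler0.
by rewrite scalerA divff ?scale1r// gt_eqF// nrm_gt0.
Qed.

(* The reflection in the hyperplane bisecting [a] and [b]. *)
Lemma exists_reflection a b : nrm a = 1 -> nrm b = 1 ->
  exists U : (I -> R) -> (I -> R),
    [/\ involutive U, forall x, nrm (U x) = nrm x,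
        forall x y, nrm (U x - U y) = nrm (x - y) &
        forall x, dot a (U x) = dot b x].
Proof.
move=> a1 b1; have [->|ab] := eqVneq a b; first by exists id; split.
have [v vE] : exists v, v = a - b by exists (a - b).
have v0 : dot v v != 0.
  by apply: contra_neq ab => /dot_eq0/eqP; rewrite vE subr_eq0 => /eqP.
have av : dot a a = 1 by rewrite -sqr_nrm a1 expr1n.
have bv : dot b b = 1 by rewrite -sqr_nrm b1 expr1n.
have vv : dot v v = 2 * dot a v.
  by rewrite vE !dotBl !dotBr av bv (dotC b a); ring.
pose U x := x - (2 * dot v x / dot v v) *: v.
have UB x y : U x - U y = U (x - y).
  by rewrite /U dotBr mulrBr mulrBl scalerBl !opprD !opprK addrACA.
have Un x : nrm (U x) = nrm x.
  congr Num.sqrt; rewrite /U dotBl !dotBr !dotZl !dotZr (dotC x v).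
  by field.
exists U; split=> // [x|x y|x]; last 1 first.
- have -> : dot b x = dot a x - dot v x by rewrite vE dotBl opprB addrC subrK.
  rewrite /U dotBr dotZr; congr (_ - _).
  have -> : dot a v = dot v v / 2 by rewrite vv mulrAC divff ?mul1r// pnatr_eq0.
  by field.
- have Uv : dot v (U x) = - dot v x by rewrite /U dotBr dotZr; field.
  rewrite {1}/U Uv /U mulrN mulNr scaleNr opprK.
  by rewrite subrK.
- by rewrite UB Un.
Qed.

End Euclidean.

Arguments unitv {R I}.

(** * Hall's marriage theorem *)

Section Marriage.
Local Close Scope classical_set_scope.
Variables (T U : finType) (u0 : U).
Implicit Types (r : T -> U -> bool) (A B C : {set T}).

Definition neighbours r B : {set U} := [set u | [exists t in B, r t u]].

Lemma neighboursP r B u :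
  reflect (exists2 t, t \in B & r t u) (u \in neighbours r B).
Proof. by rewrite inE; exact: exists_inP. Qed.

(** Induction on the size of [A]. If some nonempty proper subset is tight, it and its complement are
    matched separately; otherwise every such subset has a neighbour to spare, and one arbitrary pair
    can be fixed. [u0] provides a function when [A] is empty. *)
Lemma hall_marriage r A :
  (forall B, B \subset A -> (#|B| <= #|neighbours r B|)%N) ->
  exists f : T -> U, {in A &, injective f} /\ {in A, forall t, r t (f t)}.
Proof.
have [n] := ubnP #|A|; elim: n r A => // n IHn r A; rewrite ltnS => An hA.
have [-> | [t0 At0]] := set_0Vmem A.
  by exists (fun=> u0); split => t; rewrite ?inE // => t'; rewrite inE.
have [[B [BA Bn0 Bt]]|tight] := pselect (exists B : {set T},
    [/\ B \proper A, B != finset.set0 & (#|neighbours r B| <= #|B|)%N]).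
- have BsA := proper_sub BA.
  have [||f1 [f1i f1r]] := IHn r B.
  + by apply: leq_trans An; exact: proper_card.
  + by move=> C CB; apply: hA; exact: fintype.subset_trans BsA.
  (* The neighbours of [B] are withheld. Hall's condition survives: apply the old one to [B :|: C]
     and subtract the at most [#|B|] neighbours of [B]. *)
  pose r' t u := r t u && (u \notin neighbours r B).
  have [||f2 [f2i f2r]] := IHn r' (A :\: B).
  + apply: leq_trans An; apply: proper_card; rewrite properE subsetDl /=.
    apply/negP => /fintype.subsetP sAB; have [t Bt'] := set0Pn _ Bn0.
    by have := sAB t (fintype.subsetP BsA _ Bt'); rewrite !inE Bt'.
  + move=> C CA; rewrite -(leq_add2l #|B|).
    have dBC : B :&: C = finset.set0.
      apply/finset.setP => t; rewrite !inE; apply/negP => /andP[Bt' Ct].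
      by have := fintype.subsetP CA _ Ct; rewrite !inE Bt'.
    have <- : #|B :|: C| = (#|B| + #|C|)%N by rewrite cardsU dBC cards0 subn0.
    apply: (leq_trans (hA _ _)).
      by rewrite finset.subUset BsA (fintype.subset_trans CA)// subsetDl.
    have : neighbours r (B :|: C) \subset neighbours r B :|: neighbours r' C.
      apply/fintype.subsetP => u /neighboursP[t]; rewrite inE => tBC rtu.
      have [uB|uB] := boolP (u \in neighbours r B); rewrite finset.in_setU ?uB//=.
      rewrite (negPf uB)/=; apply/neighboursP; exists t; last by rewrite /r' rtu.
      case/orP: tBC => // tB; case/neighboursP: uB; by exists t.
    move/subset_leq_card => /leq_trans; apply.
    apply: leq_trans (leq_card_setU _ _) _; by rewrite leq_add2r.
  exists (fun t => if t \in B then f1 t else f2 t); split=> [t t' At At'|t At].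
    have f12 s s' : s \in B -> s' \in A -> s' \notin B -> f1 s <> f2 s'.
      move=> sB s'A s'B e; have := f2r s'; rewrite inE s'A s'B => /(_ isT).
      move=> /andP[_ /negP]; apply; rewrite -e; apply/neighboursP.
      by exists s => //; exact: f1r.
    case: (boolP (t \in B)) => tB; case: (boolP (t' \in B)) => t'B.
    - exact: f1i.
    - by move/f12; case.
    - by move/esym/f12; case.
    - by apply: f2i; rewrite inE ?tB ?t'B.
  case: ifPn => tB; first exact: f1r.
  by have := f2r t; rewrite inE tB At => /(_ isT) /andP[].
- have /card_gt0P[u1 /neighboursP[t]] : (0 < #|neighbours r [set t0]|)%N.
    by apply: (leq_trans _ (hA _ _)); rewrite ?cards1// finset.sub1set.
  rewrite inE => /eqP -> rtu.
  (* A nonempty [C] in [A :\ t0] is not tight, hence has at least [#|C| + 1] neighbours and can lose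
     [u1]. *)
  pose r' t u := r t u && (u != u1).
  have A'A : A :\ t0 \proper A by exact: properD1.
  have [||f [fi fr]] := IHn r' (A :\ t0).
  + by apply: leq_trans An; exact: proper_card.
  + move=> C CA; have [->|C0] := eqVneq C finset.set0; first by rewrite cards0.
    have : neighbours r C \subset u1 |: neighbours r' C.
      apply/fintype.subsetP => u /neighboursP[t' tC rtu'].
      rewrite in_setU1; have [//|uu1] := eqVneq u u1.
      by apply/neighboursP; exists t' => //; rewrite /r' rtu'.
    move/subset_leq_card => h; rewrite -ltnS.
    apply: (@leq_trans #|neighbours r C|); last first.
      by apply: (leq_trans h); rewrite cardsU1 addnC -addn1 leq_add2l leq_b1.
    rewrite ltnNge; apply/negP => h2; apply: tight; exists C; split=> //.
    exact: fintype.sub_proper_trans CA A'A.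
  exists (fun t => if t == t0 then u1 else f t); split=> [s s' sA s'A|s sA].
    have fu t' : t' \in A -> t' != t0 -> f t' != u1.
      by move=> At' tt'; have := fr t'; rewrite !inE tt' At' => /(_ isT)/andP[].
    case: (eqVneq s t0) => [->|ss]; case: (eqVneq s' t0) => [->|ss'] //.
    - by move=> /esym/eqP; rewrite (negPf (fu _ s'A ss')).
    - by move=> /eqP; rewrite (negPf (fu _ sA ss)).
    - by apply: fi; rewrite !inE ?ss ?ss'.
  case: eqVneq => [->//|ss]; have := fr s; rewrite !inE ss sA => /(_ isT).
  by case/andP.
Qed.

End Marriage.

(** * Almost rotation invariant point systems *)

Section SphereNets.
Variables (R : realType) (I : finType).
Implicit Types (x y a b : I -> R) (d : R).

Definition sphere_net n (w : 'I_n -> I -> R) d : Prop :=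
  (forall i, nrm (w i) = 1) /\
  (forall x, nrm x = 1 -> exists i, nrm (x - w i) <= d).

(** The cube [-1, 1]^I is cut into finitely many cells of side [h] with [h * s <= d], and a unit
    vector is chosen in each cell that contains one. *)
Lemma exists_sphere_net d : 0 < d -> exists n (w : 'I_n -> I -> R), sphere_net w d.
Proof.
move=> d0; have [[x0 x01]|nox] := pselect (exists x : I -> R, nrm x = 1); last first.
  have w0 : 'I_0 -> I -> R by case.
  by exists 0%N, w0; split=> [[]//|x x1]; case: nox; exists x.
pose s : R := Num.sqrt #|I|%:R; have s0 : 0 <= s by exact: sqrtr_ge0.
have [h h0 hs] : exists2 h : R, 0 < h & h * s <= d.
  exists (d / (s + 1)); first by rewrite divr_gt0// ltr_wpDl.
  by rewrite -mulrA ger_pMr// mulrC ler_pdivrMr ?mul1r ?lerDl// ltr_wpDl.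
pose m := Num.truncn (2 / h).
pose cell x : {ffun I -> 'I_m.+1} :=
  [ffun i => inord (Num.truncn ((x i + 1) / h))].
have cellP x y : nrm x = 1 -> nrm y = 1 -> cell x = cell y -> nrm (x - y) <= d.
  move=> x1 y1 e; apply: le_trans hs; apply: nrm_le_bound => [|i]; first exact: ltW.
  have /(congr1 (@nat_of_ord _)) := congr1 (fun c : {ffun I -> 'I_m.+1} => c i) e.
  have small (z : I -> R) : nrm z = 1 -> 0 <= z i + 1 /\ z i + 1 <= 2.
    by move=> z1; have := coord_le_nrm z i; rewrite z1 ler_norml; lra.
  have [x0' x2] := small _ x1; have [y0' y2] := small _ y1.
  rewrite /= !ffunE !inordK; last 2 first.
  - by rewrite ltnS le_truncn// ler_pM2r ?invr_gt0.
  - by rewrite ltnS le_truncn// ler_pM2r ?invr_gt0.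
  move=> et.
  have /andP[] := truncn_itv (divr_ge0 x0' (ltW h0)).
  have /andP[] := truncn_itv (divr_ge0 y0' (ltW h0)).
  rewrite et; move: (Num.truncn _) => k; rewrite -natr1.
  rewrite !ler_pdivlMr// !ltr_pdivrMr// mulrDl mul1r /= ler_norml.
  by rewrite -[(x - y) i]/(x i - y i); lra.
pose rep c := if pselect (exists x, nrm x = 1 /\ cell x = c) is left h
  then sval (cid h) else x0.
exists #|{: {ffun I -> 'I_m.+1}}|, (fun i => rep (enum_val i)); split=> [i|x x1].
  by rewrite /rep; case: pselect => // h'; case: cid => y [].
exists (enum_rank (cell x)); rewrite enum_rankK /rep.
case: pselect => [h'|[]]; last by exists x.
by case: cid => y [y1 yx] /=; exact: cellP.
Qed.

(** A finite substitute for the rotation invariant law on the sphere: for uniform [o], the laws of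
    [dot a (f o)] and [dot b (f o)] agree up to [d] after the relabelling [p], and [neg] realises
    the symmetry about the origin. *)
Definition almost_invariant (Om : finType) (f : Om -> I -> R) (neg : Om -> Om) d :=
  [/\ forall o, nrm (f o) = 1, forall o, f (neg o) = - f o, involutive neg &
      forall a b, nrm a = 1 -> nrm b = 1 -> exists p : Om -> Om,
        injective p /\ forall o, `|dot a (f o) - dot b (f (p o))| <= d].

(* A net of minimal cardinality and its image under an isometry are matched by
   Hall's theorem: replacing a set of points by its (smaller) set of neighbours
   would produce a smaller net. *)
Lemma minimal_net_matching n (w : 'I_n -> I -> R) d (U : (I -> R) -> I -> R) :
    sphere_net w d ->
    (forall k (w' : 'I_k -> I -> R), sphere_net w' d -> (n <= k)%N) ->
    involutive U -> (forall x, nrm (U x) = nrm x) ->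
    (forall x y, nrm (U x - U y) = nrm (x - y)) ->
  exists p : 'I_n -> 'I_n, injective p /\ forall i, nrm (w i - U (w (p i))) <= 2 * d.
Proof.
move=> [w1 wd] minn UU Un UB.
have [n0|/card_gt0P[i0 _]] := posnP #|'I_n|.
  by exists id; split=> // i; have := max_card (pred1 i); rewrite n0 card1.
(* Related points have a common unit vector within [d], so matched points are at distance at most
   [2 * d]. *)
pose r i j := `[< exists x, [/\ nrm x = 1, nrm (x - w i) <= d &
                              nrm (x - U (w j)) <= d] >].
have [B _|p [pinj pr]] := @hall_marriage _ _ i0 r [set: 'I_n]%SET.
  set N := neighbours r B; rewrite leqNgt; apply/negP => NB.
  suff : (n <= #|~: B| + #|N|)%N.
    rewrite leqNgt => /negP; apply.
    by rewrite -[X in (_ < X)%N]card_ord -(cardsC B) addnC ltn_add2r.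
  pose w' (i : 'I_(#|~: B| + #|N|)) := match fintype.split i with
    | inl j => w (enum_val j) | inr j => U (w (enum_val j)) end.
  apply: (minn _ w'); split=> [i|x x1].
    by rewrite /w'; case: fintype.split => j; rewrite ?Un w1.
  have [i xi] := wd x x1; have [iB|iB] := boolP (i \in B); last first.
    have iC : i \in ~: B by rewrite inE.
    exists (lshift _ (enum_rank_in iC i)).
    by rewrite /w' -[lshift _ _]/(unsplit (inl _)) unsplitK enum_rankK_in.
  have [j xj] := wd (U x) (etrans (Un x) x1).
  have xUj : nrm (x - U (w j)) <= d by rewrite -UB UU.
  have jN : j \in N.
    by apply/neighboursP; exists i => //; apply/asboolP; exists x.
  exists (rshift _ (enum_rank_in jN j)).
  by rewrite /w' -[rshift _ _]/(unsplit (inr _)) unsplitK enum_rankK_in.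
exists p; split=> [i j|i]; first by apply: pinj; rewrite inE.
have /asboolP[x [_ xi xj]] := pr i (finset.in_setT _).
have -> : w i - U (w (p i)) = (w i - x) + (x - U (w (p i))) by rewrite addrA subrK.
by apply: le_trans (nrmD _ _) _; rewrite mulr_natl mulr2n lerD// nrmBC.
Qed.

(** A minimal net of mesh [d / 2] is doubled by signs to become symmetric. The reflection exchanging
    [a] and [b] moves the net, and the matching of the net with its image gives the permutation. *)
Lemma exists_almost_invariant (i0 : I) d : 0 < d ->
  exists (Om : finType) (o0 : Om) (f : Om -> I -> R) (neg : Om -> Om),
    almost_invariant f neg d.
Proof.
move=> d0; have d20 : 0 < d / 2 by rewrite divr_gt0.
pose P n := `[< exists w : 'I_n -> I -> R, sphere_net w (d / 2) >].
have exP : exists n, P n.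
  by have [n [w wn]] := exists_sphere_net d20; exists n; apply/asboolP; exists w.
case: (ex_minnP exP) => n /asboolP[w wn] minP.
have minn k (w' : 'I_k -> I -> R) : sphere_net w' (d / 2) -> (n <= k)%N.
  by move=> h; apply: minP; apply/asboolP; exists w'.
have [j0 _] := wn.2 _ (nrm_unitv R i0).
pose f (o : 'I_n * bool) : I -> R := (-1) ^+ o.2 *: w o.1.
pose neg (o : 'I_n * bool) := (o.1, ~~ o.2).
exists ('I_n * bool)%type, (j0, true), f, neg; split.
- by move=> [i s]; rewrite nrmZ normrX normrN1 expr1n mul1r wn.1.
- by move=> [i []]; rewrite /f /neg /= ?expr0 ?expr1 ?scaleN1r ?scale1r// opprK.
- by move=> [i s]; rewrite /neg /= negbK.
move=> a b a1 b1; have [U [UU Un UB Ud]] := exists_reflection b1 a1.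
have [p [pinj pw]] := minimal_net_matching wn minn UU Un UB.
exists (fun o => (p o.1, o.2)); split=> [[i s] [j t] [/pinj -> ->]//|[i s]].
rewrite /f /= !dotZr -mulrBr normrM normrX normrN1 expr1n mul1r -Ud -dotBr.
apply: le_trans (norm_dot_le _ _) _.
rewrite b1 mul1r -[w (p i)]UU UB; apply: le_trans (pw i) _; lra.
Qed.

End SphereNets.

(** * Concentration for convex Lipschitz functions *)

Section EfronStein.
Variables (R : realType) (J Om : finType) (o0 : Om).
Implicit Types (s : {ffun J -> Om}) (F G : {ffun J -> Om} -> R).

Definition upd s (i : J) (o : Om) : {ffun J -> Om} :=
  [ffun j => if j == i then o else s j].

Definition mean F : R := #|{: {ffun J -> Om}}|%:R^-1 * \sum_s F s.

(** Conditional expectation given all coordinates but [i], under the uniform law on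
    configurations. *)
Definition avg (i : J) F s : R := #|Om|%:R^-1 * \sum_o F (upd s i o).

Definition sq F : R := \sum_s F s ^+ 2.

Let N0 : (#|Om|%:R : R) != 0.
Proof. by rewrite pnatr_eq0 -lt0n; apply/card_gt0P; exists o0. Qed.

Lemma card_cfg_gt0 : 0 < (#|{: {ffun J -> Om}}|%:R : R).
Proof. by rewrite ltr0n; apply/card_gt0P; exists [ffun=> o0]. Qed.

Lemma upd_upd s i o o' : upd (upd s i o) i o' = upd s i o'.
Proof. by apply/ffunP => j; rewrite !ffunE; case: eqP. Qed.

Lemma upd_id s i : upd s i (s i) = s.
Proof. by apply/ffunP => j; rewrite !ffunE; case: eqP => [->|]. Qed.

Lemma updC s i j o o' : i != j -> upd (upd s i o) j o' = upd (upd s j o') i o.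
Proof.
move=> ij; apply/ffunP => k; rewrite !ffunE.
by case: (eqVneq k j) => [->|//]; rewrite eq_sym (negPf ij).
Qed.

(** Exchangeability of the old and the fresh value of coordinate [i]: swapping them is an involution
    of the pairs (configuration, fresh value). *)
Lemma sum_upd_swap (H : {ffun J -> Om} -> {ffun J -> Om} -> R) i :
  \sum_s \sum_o H s (upd s i o) = \sum_s \sum_o H (upd s i o) s.
Proof.
pose h (p : {ffun J -> Om} * Om) := (upd p.1 i p.2, p.1 i).
have hK : involutive h.
  by move=> [s o]; rewrite /h /= upd_upd upd_id ffunE eqxx.
rewrite !pair_big /= (reindex_inj (inv_inj hK)) /=.
by apply: eq_bigr => -[s o] _ /=; rewrite upd_upd upd_id.
Qed.

Lemma sum_upd F i : \sum_s \sum_o F (upd s i o) = #|Om|%:R * \sum_s F s.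
Proof.
rewrite (sum_upd_swap (fun _ s => F s)) mulr_sumr; apply: eq_bigr => s _.
by rewrite sumr_const mulr_natl.
Qed.

Lemma sum_avg F i : \sum_s avg i F s = \sum_s F s.
Proof. by rewrite -mulr_sumr sum_upd mulKf. Qed.

Lemma avg_upd F i s o : avg i F (upd s i o) = avg i F s.
Proof. by congr (_ * _); apply: eq_bigr => o' _; rewrite upd_upd. Qed.

Lemma avgC F i j s : avg i (avg j F) s = avg j (avg i F) s.
Proof.
have [->//|ij] := eqVneq i j.
rewrite /avg; congr (_ * _); rewrite -!mulr_sumr; congr (_ * _).
by rewrite exchange_big; apply: eq_bigr => o _; apply: eq_bigr => o' _; rewrite updC.
Qed.

Lemma avgB F G i s : avg i (fun s => F s - G s) s = avg i F s - avg i G s.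
Proof. by rewrite /avg sumrB mulrBr. Qed.

(** [avg i] is an orthogonal projection; Pythagoras' theorem [sq_avg] follows. *)
Lemma sum_mul_avg F i : \sum_s F s * avg i F s = sq (avg i F).
Proof.
rewrite -(sum_avg _ i); apply: eq_bigr => s _.
rewrite {1}/avg expr2 {2}/avg -mulrA; congr (_ * _); rewrite mulr_suml.
by apply: eq_bigr => o _; rewrite avg_upd.
Qed.

Lemma sq_avg F i : sq F - sq (avg i F) = sq (fun s => F s - avg i F s).
Proof.
have -> : sq (fun s => F s - avg i F s) =
    sq F - 2 * (\sum_s F s * avg i F s) + sq (avg i F).
  rewrite /sq mulr_sumr -sumrB -big_split /=.
  by apply: eq_bigr => s _; ring.
by rewrite sum_mul_avg; ring.
Qed.

Lemma sq_ge0 F : 0 <= sq F.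
Proof. by apply: sumr_ge0 => s _; exact: sqr_ge0. Qed.

Lemma sq_avg_le F i : sq (avg i F) <= sq F.
Proof. by rewrite -subr_ge0 sq_avg sq_ge0. Qed.

Definition avgs (l : seq J) F := foldr avg F l.

Lemma sq_avgs_le l F : sq (avgs l F) <= sq F.
Proof. by elim: l => //= i l; apply: le_trans; exact: sq_avg_le. Qed.

Lemma avgs_avg l i F : avgs l (avg i F) = avg i (avgs l F).
Proof.
by elim: l => //= j l ->; apply/funext => s; rewrite avgC.
Qed.

Lemma avgsB l F G : avgs l (fun s => F s - G s) = fun s => avgs l F s - avgs l G s.
Proof. by elim: l => //= j l ->; apply/funext => s; rewrite avgB. Qed.

(** Averaging over one more coordinate [i] loses exactly [sq] of [avgs l] applied to [F - avg i F],
    and [avgs l] is a contraction. *)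
Lemma sq_avgs l F :
  sq F - sq (avgs l F) <= \sum_(i <- l) sq (fun s => F s - avg i F s).
Proof.
elim: l => [|i l IH]; first by rewrite big_nil subrr.
rewrite big_cons /=.
have := sq_avgs_le l (fun s => F s - avg i F s).
by rewrite avgsB avgs_avg -sq_avg; lra.
Qed.

Lemma avgs_local l F s s' : (forall j, j \notin l -> s j = s' j) ->
  avgs l F s = avgs l F s'.
Proof.
elim: l s s' => [|i l IH] s s' h /=.
  by congr F; apply/ffunP => j; exact: h.
congr (_ * _); apply: eq_bigr => o _; apply: IH => j jl; rewrite !ffunE.
by case: eqVneq => // ji; apply: h; rewrite inE negb_or ji.
Qed.

Lemma sum_avgs l F : \sum_s avgs l F s = \sum_s F s.
Proof. by elim: l => //= i l IH; rewrite sum_avg. Qed.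

Lemma avgs_enum F s : avgs (enum J) F s = mean F.
Proof.
rewrite /mean -(sum_avgs (enum J)); set A := avgs _ _.
have -> : \sum_s' A s' = \sum_(s' : {ffun J -> Om}) A s.
  by apply: eq_bigr => s' _; apply: avgs_local => j; rewrite mem_enum.
by rewrite sumr_const -(mulr_natl (A s)) mulKf// gt_eqF// card_cfg_gt0.
Qed.

Lemma sum_sqr_mean F : \sum_s (F s - mean F) ^+ 2 = sq F - sq (avgs (enum J) F).
Proof.
have -> : sq (avgs (enum J) F) = #|{: {ffun J -> Om}}|%:R * mean F ^+ 2.
  rewrite /sq (eq_bigr (fun=> mean F ^+ 2)) => [|s _]; last by rewrite avgs_enum.
  by rewrite sumr_const mulr_natl.
have e : \sum_s F s = #|{: {ffun J -> Om}}|%:R * mean F.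
  by rewrite /mean mulVKf// gt_eqF// card_cfg_gt0.
transitivity (\sum_s (F s ^+ 2 - 2 * mean F * F s + mean F ^+ 2)).
  by apply: eq_bigr => s _; ring.
rewrite big_split sumrB /= -mulr_sumr e sumr_const -(mulr_natl (mean F ^+ 2)).
by rewrite -/(sq F); ring.
Qed.

Lemma sum_sqr_upd F i : \sum_s \sum_o (F s - F (upd s i o)) ^+ 2 =
  2 * #|Om|%:R * sq (fun s => F s - avg i F s).
Proof.
rewrite -sq_avg.
transitivity (\sum_s (#|Om|%:R * F s ^+ 2 - 2 * #|Om|%:R * (F s * avg i F s) +
                      \sum_o F (upd s i o) ^+ 2)).
  apply: eq_bigr => s _.
  transitivity (\sum_o (F s ^+ 2 - 2 * F s * F (upd s i o) + F (upd s i o) ^+ 2)).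
    by apply: eq_bigr => o _; ring.
  rewrite big_split sumrB /= sumr_const -mulr_sumr -(mulr_natl (F s ^+ 2)).
  have -> : \sum_o F (upd s i o) = #|Om|%:R * avg i F s by rewrite mulVKf.
  by ring.
rewrite big_split sumrB /= -!mulr_sumr sum_mul_avg (sum_upd (fun s => F s ^+ 2)).
by rewrite -/(sq F); ring.
Qed.

Definition pos_part (x : R) := Num.max x 0.

Lemma sqr_pos_part x : x ^+ 2 = pos_part x ^+ 2 + pos_part (- x) ^+ 2.
Proof.
rewrite /pos_part; case: (lerP x 0) => x0; case: (lerP (- x) 0) => x1; first 1 last.
- by rewrite expr0n add0r sqrrN.
- by rewrite [in RHS]expr0n addr0.
- by lra.
- have -> : x = 0 by lra.
  by rewrite expr0n addr0.
Qed.

(** Exchanging a configuration with its resampling shows that increases and decreases of [F]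
    contribute equally. Only decreases are kept, because convexity controls them. *)
Lemma sq_sub_avg F i : sq (fun s => F s - avg i F s) =
  #|Om|%:R^-1 * \sum_s \sum_o pos_part (F s - F (upd s i o)) ^+ 2.
Proof.
set P := \sum_s _; have e : 2 * P = 2 * #|Om|%:R * sq (fun s => F s - avg i F s).
  rewrite -sum_sqr_upd [RHS](eq_bigr (fun s =>
    \sum_o pos_part (F s - F (upd s i o)) ^+ 2 +
    \sum_o pos_part (F (upd s i o) - F s) ^+ 2)) => [|s _]; last first.
    rewrite -big_split; apply: eq_bigr => o _ /=.
    by rewrite sqr_pos_part opprB.
  rewrite big_split /= -(sum_upd_swap (fun s s' => pos_part (F s - F s') ^+ 2)).
  by rewrite -/P; ring.
have -> : P = #|Om|%:R * sq (fun s => F s - avg i F s) by lra.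
by rewrite mulKf.
Qed.

Theorem efron_stein F : \sum_s (F s - mean F) ^+ 2 <=
  \sum_i #|Om|%:R^-1 * \sum_s \sum_o pos_part (F s - F (upd s i o)) ^+ 2.
Proof.
rewrite sum_sqr_mean; apply: le_trans (sq_avgs _ _) _.
by rewrite big_enum; apply: ler_sum => i _; rewrite sq_sub_avg.
Qed.

(** The Efron-Stein bound averages over the fresh value separately for each [i], so after exchanging
    sums one value [o] may serve all coordinates at once. *)
Corollary variance_bound F (V : R) :
    (forall s o, \sum_i pos_part (F s - F (upd s i o)) ^+ 2 <= V) ->
  \sum_s (F s - mean F) ^+ 2 <= #|{: {ffun J -> Om}}|%:R * V.
Proof.
move=> h; apply: le_trans (efron_stein F) _; rewrite -mulr_sumr exchange_big /=.
have -> : #|{: {ffun J -> Om}}|%:R * V = \sum_(s : {ffun J -> Om}) V.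
  by rewrite sumr_const mulr_natl.
rewrite mulr_sumr; apply: ler_sum => s _.
rewrite exchange_big /= ler_pdivrMl ?lt_def ?N0 ?ler0n//.
have -> : #|Om|%:R * V = \sum_(o : Om) V by rewrite sumr_const mulr_natl.
by apply: ler_sum => o _; exact: h.
Qed.

End EfronStein.

(** * Decrease of convex Lipschitz functions along the coordinate directions *)

Section ConvexLipschitz.
Variables (R : realType) (J : finType).
Implicit Types (x y z : J -> R) (g : (J -> R) -> R) (w : R).

Definition conv_lip w g : Prop :=
  (forall x y t, 0 <= t <= 1 ->
     g (t *: x + (1 - t) *: y) <= t * g x + (1 - t) * g y) /\
  (forall x y, `|g x - g y| <= w * nrm (x - y)).

(** Jensen's inequality with the remaining weight at [x]; strictness of the weight bound permits the
    division by [1 - t] in the induction. *)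
Lemma conv_lip_jensen w g (K : Type) (l : seq K) (th : K -> R) (z : K -> J -> R) x :
    conv_lip w g -> (forall k, 0 <= th k) -> \sum_(k <- l) th k < 1 ->
  g (x + \sum_(k <- l) th k *: z k) <=
  g x + \sum_(k <- l) th k * (g (x + z k) - g x).
Proof.
move=> [cg _]; elim: l th => [|k l IH] th th0; first by rewrite !big_nil !addr0.
have s0 (th' : K -> R) : (forall k, 0 <= th' k) -> 0 <= \sum_(k <- l) th' k.
  by move=> h; apply: sumr_ge0.
rewrite !big_cons => th1; set t := th k in th1 *.
have t0 : 0 <= t by exact: th0.
have t1 : 0 < 1 - t by have := s0 _ th0; lra.
pose th' j := th j / (1 - t).
have th'0 j : 0 <= th' j by rewrite divr_ge0// ltW.
have thE j : th j = (1 - t) * th' j by rewrite mulrC divfK// gt_eqF.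
have sE : \sum_(j <- l) th j *: z j = (1 - t) *: \sum_(j <- l) th' j *: z j.
  by rewrite scaler_sumr; apply: eq_bigr => j _; rewrite scalerA -thE.
have {}IH : g (x + \sum_(j <- l) th' j *: z j) <=
    g x + \sum_(j <- l) th' j * (g (x + z j) - g x).
  apply: IH => //; rewrite -mulr_suml ltr_pdivrMr// mul1r; lra.
have -> : x + (t *: z k + \sum_(j <- l) th j *: z j) =
    t *: (x + z k) + (1 - t) *: (x + \sum_(j <- l) th' j *: z j).
  by rewrite sE !scalerDr [RHS]addrACA -scalerDl [t + _]addrC subrK scale1r.
apply: le_trans (cg _ _ _ _) _; first by apply/andP; split; lra.
have -> : \sum_(j <- l) th j * (g (x + z j) - g x) =
    (1 - t) * \sum_(j <- l) th' j * (g (x + z j) - g x).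
  by rewrite mulr_sumr; apply: eq_bigr => j _; rewrite mulrA -thE.
have := ler_wpM2l (ltW t1) IH; lra.
Qed.

(* A convex function that decreases by [d i] along the i-th direction decreases
   by at least [\sum_i th i * d i] along [\sum_i th i *: h i]; for [th]
   proportional to [d], compare with the Lipschitz bound. *)
Lemma sum_sqr_decrease w g x (h : J -> R) : 0 <= w -> conv_lip w g ->
    (forall i, `|h i| <= 2) ->
  \sum_i pos_part (g x - g (x + h i *: unitv i)) ^+ 2 <= 4 * w ^+ 2.
Proof.
move=> w0 cg h2; set d := fun i => pos_part (g x - g (x + h i *: unitv i)).
have d0 i : 0 <= d i by rewrite /d /pos_part le_max lexx orbT.
pose D := \sum_i d i ^+ 2; rewrite -/D.
have D0 : 0 <= D by apply: sumr_ge0 => i _; exact: sqr_ge0.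
have S0 : 0 <= \sum_i d i by apply: sumr_ge0.
(* The summand 1 makes the total weight [l * \sum_i d i] strictly less than 1, as Jensen's
   inequality requires. *)
pose l := (1 + \sum_i d i)^-1; have l0 : 0 < l by rewrite invr_gt0; lra.
have := @conv_lip_jensen _ g _ (index_enum J) (fun i => l * d i)
          (fun i => h i *: unitv i) x cg.
have -> : \sum_(i <- index_enum J) l * d i *: (h i *: unitv i) =
    (fun j => l * d j * h j) :> (J -> R).
  apply/funext => j; rewrite fct_sumE (bigD1 j)//= big1 => [|i ij].
    by rewrite addr0 -[LHS]/(l * d j * (h j * (j == j)%:R)) eqxx mulr1.
  rewrite -[LHS]/(l * d i * (h i * (j == i)%:R)).
  by rewrite eq_sym (negPf ij) !mulr0.
set y : J -> R := fun j => _.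
have -> : \sum_(i <- index_enum J) l * d i * (g (x + h i *: unitv i) - g x) =
    - (l * D).
  rewrite /D mulr_sumr -sumrN; apply: eq_bigr => i _.
  rewrite -mulrA -mulrN; congr (_ * _); rewrite expr2 -mulrN.
  rewrite /d /pos_part; case: (lerP (g x - g (x + h i *: unitv i)) 0) => ?.
    by rewrite !mul0r.
  by congr (_ * _); rewrite opprB.
move=> jensen; have {}jensen : g (x + y) <= g x - l * D.
  apply: jensen => [i|]; first by rewrite mulr_ge0// ltW.
  rewrite -mulr_sumr /l mulrC ltr_pdivrMr ?mul1r; lra.
have ny : nrm y <= 2 * l * Num.sqrt D.
  rewrite -(@ler_pXn2r _ 2)// ?nnegrE ?mulr_ge0 ?sqrtr_ge0 ?nrm_ge0 ?(ltW l0)//.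
  rewrite sqr_nrm exprMn sqr_sqrtr// /D mulr_sumr; apply: ler_sum => i _.
  have -> : y i * y i = (l * d i) ^+ 2 * h i ^+ 2 by rewrite /y; ring.
  have -> : (2 * l) ^+ 2 * d i ^+ 2 = (l * d i) ^+ 2 * 2 ^+ 2 by ring.
  rewrite ler_wpM2l ?sqr_ge0//.
  by rewrite -[h i ^+ 2]real_normK ?num_real// ler_pXn2r ?nnegrE.
have lip : l * D <= w * (2 * l * Num.sqrt D).
  have := cg.2 x (x + y); rewrite opprD addNKr nrmN => hl.
  have := ler_wpM2l w0 ny; have := ler_norm (g x - g (x + y)); lra.
have {lip} hq : D <= 2 * w * Num.sqrt D.
  rewrite -(ler_pM2l l0); apply: le_trans lip _.
  by rewrite le_eqVlt; apply/orP; left; apply/eqP; ring.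
have q0 := sqrtr_ge0 D; have qD := sqr_sqrtr D0.
have q2 : Num.sqrt D <= 2 * w.
  have [->|qn0] := eqVneq (Num.sqrt D) 0; first by rewrite mulr_ge0.
  have qp : 0 < Num.sqrt D by rewrite lt_def qn0.
  by rewrite -(ler_pM2r qp) -expr2 qD.
rewrite -qD; have -> : 4 * w ^+ 2 = (2 * w) ^+ 2 by ring.
by rewrite ler_pXn2r ?nnegrE ?mulr_ge0.
Qed.

End ConvexLipschitz.

(** * Concentration for images of unit vectors under a random matrix *)

Section Concentration.
Variables (R : realType) (I J Om : finType) (o0 : Om) (f : Om -> I -> R).
Variables (neg : Om -> Om) (d : R).
Hypothesis invf : almost_invariant f neg d.
Implicit Types (a b : I -> R) (s : {ffun J -> Om}) (g : (J -> R) -> R).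

(** The matrix with rows [v k], applied to the vector [a]. *)
Definition rowmap (K : finType) (v : K -> I -> R) a : K -> R := fun k => dot a (v k).

Definition sample s : J -> I -> R := fun j => f (s j).

Lemma row_upd a s i o : rowmap (sample (upd s i o)) a =
  rowmap (sample s) a + (dot a (f o) - dot a (f (s i))) *: unitv i.
Proof.
apply/funext => j; rewrite /rowmap /sample ffunE.
rewrite -[RHS]/(dot a (f (s j)) + (dot a (f o) - dot a (f (s i))) * (j == i)%:R).
by case: eqP => [->|_]; rewrite ?mulr1 ?mulr0 ?addr0// addrC subrK.
Qed.

Lemma norm_dot_sample a o : nrm a = 1 -> `|dot a (f o)| <= 1.
Proof.
by move=> a1; case: invf => f1 _ _ _; apply: le_trans (norm_dot_le _ _) _;
  rewrite a1 f1 mul1r.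
Qed.

(** Resampling row [i] moves only coordinate [i] of the image, by at most 2. The resulting variance
    bound does not depend on the number of rows. *)
Lemma variance_row w g a : 0 <= w -> conv_lip w g -> nrm a = 1 ->
  \sum_s (g (rowmap (sample s) a) - mean (fun s => g (rowmap (sample s) a))) ^+ 2
    <= #|{: {ffun J -> Om}}|%:R * (4 * w ^+ 2).
Proof.
move=> w0 cg a1; apply: (variance_bound o0) => s o.
under eq_bigr => i _ do rewrite row_upd.
apply: (@sum_sqr_decrease _ _ w g _ (fun i => dot a (f o) - dot a (f (s i)))) => // i.
apply: le_trans (ler_normB _ _) _.
by have := norm_dot_sample o a1; have := norm_dot_sample (s i) a1; lra.
Qed.

(** Relabelling every row by the permutation that carries [a] to [b] preserves the uniform law and
    moves each coordinate by at most [d]. *)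
Lemma mean_row_near w g a b : 0 <= w -> conv_lip w g -> nrm a = 1 -> nrm b = 1 ->
  `|mean (fun s => g (rowmap (sample s) a)) - mean (fun s => g (rowmap (sample s) b))|
    <= w * (d * Num.sqrt #|J|%:R).
Proof.
move=> w0 cg a1 b1; case: invf => _ _ _ /(_ a b a1 b1)[p [pinj pd]].
pose h s : {ffun J -> Om} := [ffun j => p (s j)].
have hinj : injective h.
  move=> s s' /ffunP e; apply/ffunP => j; have := e j.
  by rewrite !ffunE => /pinj.
have N0 := card_cfg_gt0 R J o0.
rewrite /mean -mulrBr [X in _ * (_ - X)](reindex_inj hinj) /= -sumrB normrM.
rewrite ger0_norm ?invr_ge0 ?ler0n// ler_pdivrMl//.
apply: le_trans (ler_norm_sum _ _ _) _.
rewrite mulr_natl -sumr_const; apply: ler_sum => s _.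
apply: le_trans (cg.2 _ _) _; apply: ler_wpM2l => //.
apply: nrm_le_bound => [|j]; first by apply: le_trans (pd o0).
by rewrite -[(_ - _) j]/(dot a (f (s j)) - dot b (f (h s j))) ffunE.
Qed.

(** Second moment method: some sample has a sum of squared deviations, over all functions and
    points, that is at most its average, and this sum bounds each deviation. *)
Lemma concentration (G A : finType) (g : G -> (J -> R) -> R) (a : A -> I -> R) w :
    0 <= w -> (forall c, conv_lip w (g c)) -> (forall k, nrm (a k) = 1) ->
  exists s, forall c k,
    `|g c (rowmap (sample s) (a k)) - mean (fun s => g c (rowmap (sample s) (a k)))|
      <= 2 * w * Num.sqrt (#|G| * #|A|)%:R.
Proof.
move=> w0 cg a1; pose F c k s := g c (rowmap (sample s) (a k)).
have N0 := card_cfg_gt0 R J o0.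
pose V s := \sum_c \sum_k (F c k s - mean (F c k)) ^+ 2.
pose B := (#|G| * #|A|)%:R * (4 * w ^+ 2).
have sV : \sum_s V s <= #|{: {ffun J -> Om}}|%:R * B.
  rewrite /V exchange_big /=; under eq_bigr do rewrite exchange_big /=.
  have -> : #|{: {ffun J -> Om}}|%:R * B =
      \sum_(c : G) \sum_(k : A) #|{: {ffun J -> Om}}|%:R * (4 * w ^+ 2).
    rewrite !sumr_const -mulrnA mulnC -[RHS]mulr_natl /B; ring.
  apply: ler_sum => c _; apply: ler_sum => k _; exact: variance_row.
have [s Vs] : exists s, V s <= B.
  apply: contrapT => /forallNP h.
  suff : \sum_(s : {ffun J -> Om}) B < \sum_s V s.
    by rewrite ltNge sumr_const -(mulr_natl B) sV.
  apply: ltr_sum => [|s _]; first by apply/hasP; exists [ffun=> o0].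
  by rewrite ltNge; apply/negP; exact: h.
exists s => c k; rewrite -/(F c k s).
have h : (F c k s - mean (F c k)) ^+ 2 <= B.
  apply: le_trans Vs; rewrite /V (bigD1 c)//= (bigD1 k)//= -addrA lerDl.
  by rewrite addr_ge0// ?sumr_ge0// => *; rewrite ?sumr_ge0// => *; exact: sqr_ge0.
rewrite -(@ler_pXn2r _ 2)// ?nnegrE ?normr_ge0 ?mulr_ge0 ?sqrtr_ge0//.
rewrite real_normK ?num_real//; apply: le_trans h _.
rewrite !exprMn sqr_sqrtr ?ler0n// /B.
by rewrite le_eqVlt; apply/orP; left; apply/eqP; ring.
Qed.

End Concentration.

(** * The Dvoretzky-Rogers lemma *)

Section LinearCombinations.
Variables (R : realType) (I : finType) (X : normedModType R).
Implicit Types (v : I -> X) (x y : I -> R).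

Definition lc v x : X := \sum_i x i *: v i.

Lemma lcD v x y : lc v (x + y) = lc v x + lc v y.
Proof. by rewrite -big_split; apply: eq_bigr => i _; exact: scalerDl. Qed.

Lemma lcZ v (t : R) x : lc v (t *: x) = t *: lc v x.
Proof. by rewrite scaler_sumr; apply: eq_bigr => i _; rewrite scalerA. Qed.

Lemma lcN v x : lc v (- x) = - lc v x.
Proof. by rewrite -scaleN1r lcZ scaleN1r. Qed.

Lemma lcB v x y : lc v (x - y) = lc v x - lc v y.
Proof. by rewrite lcD lcN. Qed.

Lemma lc0 v : lc v 0 = 0.
Proof. by apply: big1 => i _; exact: scale0r. Qed.

Lemma norm_lc_le v x : `|lc v x| <= (\sum_i `|v i|) * nrm x.
Proof.
apply: le_trans (ler_norm_sum _ _ _) _; rewrite mulr_suml; apply: ler_sum => i _.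
by rewrite normrZ mulrC ler_wpM2l// coord_le_nrm.
Qed.

End LinearCombinations.

(** * Independent families and bounds on their coordinates *)

Section FiniteDimensionalSubspaces.
Variables (R : realType) (X : normedModType R).

Definition lin_indep n (b : 'I_n -> X) : Prop := forall c, lc b c = 0 -> c = 0.

Lemma exists_lin_indep n : infinite_dimensional X -> exists b : 'I_n -> X, lin_indep b.
Proof.
move=> infX; elim: n => [|n [b bI]].
  by exists (fun=> 0) => c _; apply/funext; case.
have /existsNP[x nx] : ~ forall x, exists c : 'I_n -> R, x = lc b c.
  by move=> h; apply: infX; exists n, b.
exists (fun i => if unlift ord_max i is Some j then b j else x) => c.
rewrite /lc big_ord_recr /= unlift_none.
under eq_bigr => i _.
  have -> : widen_ord (leqnSn n) i = lift ord_max i.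
    by apply/val_inj; rewrite /= /bump leqNgt ltn_ord.
  rewrite liftK; over.
rewrite -[\sum_i _]/(lc b (fun i => c (lift ord_max i))) => e.
have cm : c ord_max = 0.
  apply: contrapT => /eqP cm; apply: nx.
  exists (- (c ord_max)^-1 *: (fun i => c (lift ord_max i))).
  rewrite lcZ scaleNr; apply/eqP; rewrite -addr_eq0; apply/eqP.
  apply: (scalerI cm); rewrite scalerDr scalerA mulfV// scale1r scaler0 addrC.
  by rewrite e.
move: e; rewrite cm scale0r addr0 => /bI e; apply/funext => i.
have [j ->|->//] := unliftP ord_max i.
by have := congr1 (fun f : 'I_n -> R => f j) e.
Qed.

(** The norm of the combination is continuous on the compact unit sphere of the coordinate space and
    vanishes nowhere there, so it has a positive minimum. *)
Lemma lin_indep_bound n (b : 'I_n -> X) : lin_indep b ->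
  exists2 m : R, 0 < m & forall c i, m * `|c i| <= `|lc b c|.
Proof.
case: n b => [b _|n b bI]; first by exists 1 => // c [].
pose phi (v : 'rV[R]_n.+1) : R := `|lc b (fun i => v ord0 i)|.
have phic : continuous phi.
  move=> v; apply: (@continuous_comp _ _ _ _ (fun z : X => `|z|)).
    move: v; apply: continuous_big => [|i _ v]; first exact: add_continuous.
    have ci := @coord_continuous R 1 n.+1 ord0 i v.
    exact: (cvgZ ci (cvg_cst (b i))).

  exact: norm_continuous.
pose S : set 'rV[R]_n.+1 := [set v | `|v| = 1].
have Sc : compact S.
  apply: bounded_closed_compact.
    exists 1; split=> // M M1 v /= ->; exact: ltW.
  have -> : S = (fun v : 'rV[R]_n.+1 => `|v|) @^-1` [set 1] by [].
  apply: closed_comp => [v _|]; first exact: norm_continuous.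
  exact: closed_eq.
have vn0 (v : 'rV[R]_n.+1) : v != 0 -> S (`|v|^-1 *: v).
  move=> v0; rewrite /S /= normrZ normrV ?unitfE ?normr_eq0// normr_id.
  by rewrite mulVf// normr_eq0.
have S0 : S !=set0.
  exists (`|const_mx 1 : 'rV[R]_n.+1|^-1 *: const_mx 1); apply: vn0.
  by apply/eqP => /matrixP/(_ ord0 ord0); rewrite !mxE => /eqP; rewrite oner_eq0.
have [u uS umin] := compact_EVT_min S0 Sc (continuous_subspaceT phic).
have u1 : `|u| = 1 by rewrite inE in uS.
exists (phi u).
  rewrite /phi normr_gt0; apply/eqP => /bI e.
  have : u = 0 by apply/rowP => i; rewrite mxE; have := congr1 (fun f : 'I_n.+1 -> R => f i) e.
  by move=> u0; move: u1; rewrite u0 normr0 => /esym/eqP; rewrite oner_eq0.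
move=> c i; pose v : 'rV[R]_n.+1 := \row_j c j.
have ci : `|c i| <= `|v|.
  have -> : c i = v ord0 i by rewrite mxE.
  rewrite [leRHS]/Num.norm /= mx_normrE; apply: (le_bigmax _ (fun p => `|v p.1 p.2|) (ord0, i)).
have -> : lc b c = lc b (fun j => v ord0 j).
  by congr lc; apply/funext => j; rewrite mxE.
have [v0|v0] := eqVneq v 0.
  by move: ci; rewrite v0 normr0 normr_le0 => /eqP ->; rewrite normr0 mulr0.
have vp : 0 < `|v| by rewrite normr_gt0.
have := umin (`|v|^-1 *: v); rewrite inE => /(_ (vn0 _ v0)).
rewrite {2}/phi; have -> : (fun j => (`|v|^-1 *: v) ord0 j) = `|v|^-1 *: (fun j => v ord0 j).
  by apply/funext => j; rewrite mxE.
rewrite lcZ normrZ ger0_norm ?invr_ge0// mulrC ler_pdivlMr// => h.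
by apply: le_trans h; apply: ler_wpM2l => //; exact: normr_ge0.
Qed.

End FiniteDimensionalSubspaces.

(** * Ellipsoids of almost maximal volume in the unit ball *)

Section DvoretzkyRogers.
Variables (R : realType) (X : normedModType R).

(** Two block triangular factorisations of the same matrix are compared. *)
Lemma det_1_sub_mul n (c : 'cV[R]_n) (r : 'rV[R]_n) :
  \det (1%:M - c *m r) = 1 - (r *m c) ord0 ord0.
Proof.
have e1 : block_mx 1%:M r c 1%:M =
    block_mx 1%:M 0 c 1%:M *m block_mx 1%:M r 0 (1%:M - c *m r) :> 'M[R]_(1 + n).
  by rewrite mulmx_block !mul1mx !mul0mx !mulmx1 ?mulmx0 ?addr0 [c *m r + _]addrC subrK.
have e2 : block_mx 1%:M r c 1%:M =
    block_mx 1%:M r 0 1%:M *m block_mx (1%:M - r *m c) 0 c 1%:M :> 'M[R]_(1 + n).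
  by rewrite mulmx_block !mul1mx !mul0mx !mulmx1 ?mulmx0 ?add0r subrK.
have := congr1 determinant e1; rewrite e2 !det_mulmx !det_ublock !det_lblock.
by rewrite !det1 !mul1r mulr1 => <-; rewrite det_mx11 !mxE.
Qed.

Definition mulv n (A : 'M[R]_n) (t : 'I_n -> R) : 'I_n -> R :=
  fun i => \sum_j A i j * t j.

Lemma mulvM n (A B : 'M[R]_n) t : mulv (A *m B) t = mulv A (mulv B t).
Proof.
apply/funext => i; rewrite /mulv.
under eq_bigr => j _ do rewrite mxE mulr_suml.
rewrite exchange_big /=; apply: eq_bigr => k _; rewrite mulr_sumr.
by apply: eq_bigr => j _; rewrite mulrA.
Qed.

Lemma mulvD n (A : 'M[R]_n) s t : mulv A (s + t) = mulv A s + mulv A t.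
Proof.
apply/funext => i; rewrite -[RHS]/(mulv A s i + mulv A t i) -big_split.
by apply: eq_bigr => j _; exact: mulrDr.
Qed.

Lemma mulvZ n (A : 'M[R]_n) (c : R) t : mulv A (c *: t) = c *: mulv A t.
Proof.
apply/funext => i; rewrite -[RHS]/(c * mulv A t i) mulr_sumr.
by apply: eq_bigr => j _; rewrite mulrCA.
Qed.

Lemma mulv_unitv n (A : 'M[R]_n) i j : mulv A (unitv j) i = A i j.
Proof.
rewrite /mulv (bigD1 j)//= /unitv eqxx mulr1 big1 ?addr0// => k /negPf ->.
by rewrite mulr0.
Qed.

(** Indexing by [nat] lets a family be extended without changing its type. *)
Definition orthonormal_upto n (f : nat -> 'I_n -> R) l : Prop :=
  forall i j, (i < l)%N -> (j < l)%N -> dot (f i) (f j) = (i == j)%:R.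

Definition proj n (f : nat -> 'I_n -> R) l (t : 'I_n -> R) : 'I_n -> R :=
  \sum_(k < l) dot (f k) t *: f k.

Lemma dot_proj n (f : nat -> 'I_n -> R) l t k : orthonormal_upto f l ->
  (k < l)%N -> dot (f k) (proj f l t) = dot (f k) t.
Proof.
move=> fo kl; have dot_sum (F : 'I_l -> 'I_n -> R) x :
    dot x (\sum_i F i) = \sum_i dot x (F i).
  elim/big_rec2: _ => [|i a b _ <-]; first by rewrite dotC dot0l.
  by rewrite dotDr.
rewrite /proj dot_sum (bigD1 (Ordinal kl))//= big1 => [|j jk].
  by rewrite dotZr fo// eqxx mulr1 addr0.
rewrite dotZr fo//; case: eqP => [e|]; last by rewrite mulr0.
by move: jk; rewrite -val_eqE /= e eqxx.
Qed.

Lemma dot_proj_proj n (f : nat -> 'I_n -> R) l t : orthonormal_upto f l ->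
  dot (proj f l t) (proj f l t) = dot (proj f l t) t.
Proof.
move=> fo; have dot_sum (F : 'I_l -> 'I_n -> R) x :
    dot (\sum_i F i) x = \sum_i dot (F i) x.
  elim/big_rec2: _ => [|i a b _ <-]; first by rewrite dot0l.
  by rewrite dotDl.
rewrite {1 3}/proj !dot_sum; apply: eq_bigr => k _.
by rewrite !dotZl dot_proj.
Qed.

(* The map that equals [sqrt 2] on the orthogonal complement of
   [f 0, ..., f l.-1] and [1 / sqrt 2] on their span. *)
Definition stretch n (f : nat -> 'I_n -> R) l : 'M[R]_n :=
  Num.sqrt 2 *: (1%:M - 2^-1 *: \matrix_(i, j) \sum_(k < l) f k i * f k j).

Lemma mulv_stretch n (f : nat -> 'I_n -> R) l t :
  mulv (stretch f l) t =
  Num.sqrt 2 *: (t - proj f l t) + (Num.sqrt 2 / 2) *: proj f l t.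
Proof.
have -> : mulv (stretch f l) t = Num.sqrt 2 *: (t - 2^-1 *: proj f l t).
  apply/funext => i.
  rewrite -[RHS]/(Num.sqrt 2 * (t i - 2^-1 * proj f l t i)) /mulv /proj.
  under eq_bigr => j _ do rewrite !mxE.
  rewrite fct_sumE; transitivity (\sum_j (Num.sqrt 2 * ((i == j)%:R * t j -
      2^-1 * (\sum_(k < l) f k i * f k j) * t j))).
    by apply: eq_bigr => j _; ring.
  rewrite -mulr_sumr sumrB; congr (_ * (_ - _)).
    rewrite (bigD1 i)//= eqxx mul1r big1 ?addr0// => j ji.
    by rewrite eq_sym (negPf ji) mul0r.
  under eq_bigr => j _ do rewrite -mulrA.
  rewrite -mulr_sumr; congr (_ * _).
  under eq_bigr => j _ do rewrite mulr_suml.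
  rewrite exchange_big; apply: eq_bigr => k _ /=.
  rewrite -[RHS]/(dot (f k) t * f k i) mulr_suml; apply: eq_bigr => j _; ring.
apply/funext => i; set p := proj f l t.
rewrite -[LHS]/(Num.sqrt 2 * (t i - 2^-1 * p i)).
by rewrite -[RHS]/(Num.sqrt 2 * (t i - p i) + Num.sqrt 2 / 2 * p i); field.
Qed.

(** Since [f l] is orthogonal to the previous vectors, it contributes a separate factor
    [1%:M - c *m r], a rank one perturbation of determinant 1/2. *)
Lemma det_stretch n (f : nat -> 'I_n -> R) l : orthonormal_upto f l ->
  \det (stretch f l) = Num.sqrt 2 ^+ n * 2^-1 ^+ l.
Proof.
move=> fo; rewrite detZ; congr (_ * _).
elim: l fo => [|l IH] fo.
  rewrite [X in _ *: X](_ : _ = 0) ?scaler0 ?subr0 ?det1 ?expr0//.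
  by apply/matrixP => i j; rewrite !mxE big_ord0.
have fo' : orthonormal_upto f l by move=> i j il jl; rewrite fo// ltnW.
rewrite exprSr -(IH fo'); set M := \matrix_(i, j) \sum_(k < l) _.
pose c : 'cV[R]_n := 2^-1 *: \col_i f l i; pose r : 'rV[R]_n := \row_j f l j.
have Mc : M *m c = 0.
  apply/matrixP => i j; rewrite !mxE.
  under eq_bigr => k _ do rewrite !mxE mulr_suml.
  rewrite exchange_big /= big1// => k _.
  transitivity (2^-1 * f k i * dot (f k) (f l)).
    by rewrite /dot mulr_sumr; apply: eq_bigr => m _; ring.
  by rewrite fo ?(ltn_trans (ltn_ord k))// ltn_eqF ?mulr0// ltn_ord.
have -> : 1%:M - 2^-1 *: \matrix_(i, j) \sum_(k < l.+1) f k i * f k j =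
    (1%:M - 2^-1 *: M) *m (1%:M - c *m r).
  rewrite mulmxBr mulmx1 mulmxBl mul1mx -(scalemxAl _ M) (mulmxA M) Mc mul0mx scaler0 subr0.
  rewrite -addrA -opprD; congr (_ - _); apply/matrixP => i j.
  by rewrite !mxE big_ord_recr /= mulrDr big_ord1 !mxE; ring.
rewrite det_mulmx det_1_sub_mul; congr (_ * _).
have -> : (r *m c) ord0 ord0 = 2^-1 * dot (f l) (f l).
  by rewrite !mxE mulr_sumr; apply: eq_bigr => j _; rewrite !mxE; ring.
have -> : dot (f l) (f l) = 1 by rewrite fo// eqxx.
lra.
Qed.

(** The image of the Euclidean ball is an ellipsoid inside the unit ball of the span of [b]; the
    determinant of [A] measures its volume. *)
Definition adm n (b : 'I_n -> X) (A : 'M[R]_n) : Prop :=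
  forall t, `|lc b (mulv A t)| <= nrm t.

(** The determinants of admissible matrices are bounded, because the entries are, and a small scalar
    matrix makes their supremum positive. Coming within a factor 2 of the supremum is enough, so no
    maximiser is sought. *)
Lemma exists_near_max_det n (b : 'I_n -> X) : lin_indep b ->
  exists2 A, adm b A & 0 < \det A /\ forall B, adm b B -> \det B < 2 * \det A.
Proof.
move=> bI; have [m m0 mP] := lin_indep_bound bI.
pose S : set R := [set x | exists2 A, adm b A & x = \det A].
pose s := 1 + \sum_i `|b i|; have s0 : 0 < s by rewrite ltr_wpDr// sumr_ge0.
have mv1 t : mulv (s^-1%:M) t = s^-1 *: t.
  apply/funext => i; rewrite -[RHS]/(s^-1 * t i) /mulv (bigD1 i)//= !mxE eqxx.
  rewrite mulr1n big1 ?addr0// => j ji; rewrite !mxE eq_sym (negPf ji).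
  by rewrite mulr0n mul0r.
have S1 : S (s^-1 ^+ n).
  exists (s^-1%:M); last by rewrite det_scalar.
  move=> t; rewrite mv1 lcZ normrZ ger0_norm ?invr_ge0 ?(ltW s0)//.
  rewrite mulrC ler_pdivrMr//; apply: le_trans (norm_lc_le _ _) _.
  by rewrite mulrC ler_wpM2l ?nrm_ge0// /s lerDr.
have Sub : has_ubound S.
  exists (\sum_(p : {perm 'I_n}) m^-1 ^+ n) => _ [A admA ->].
  have Aij i j : `|A i j| <= m^-1.
    rewrite -[leRHS]mul1r ler_pdivlMr// mulrC -mulv_unitv.
    apply: le_trans (mP _ _) _; apply: le_trans (admA _) _.
    by rewrite nrm_unitv.
  apply: le_trans (ler_norm _) _; apply: le_trans (ler_norm_sum _ _ _) _.
  apply: ler_sum => p _; rewrite normrM normrX normrN1 expr1n mul1r normr_prod.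
  apply: (@le_trans _ _ (\prod_(i < n) m^-1)).
    by apply: ler_prod => i _; rewrite normr_ge0 Aij.
  by rewrite prodr_const card_ord.
have p0 : 0 < s^-1 ^+ n by rewrite exprn_gt0// invr_gt0.
have sup0 : 0 < sup S by apply: lt_le_trans p0 _; exact: ub_le_sup.
have [] := @sup_adherent _ S (sup S / 2) _ (conj (ex_intro _ _ S1) Sub).
  by rewrite divr_gt0.
move=> _ [A admA ->] hA; exists A => //; split=> [|B admB]; first lra.
have : \det B <= sup S by apply: ub_le_sup => //; exists B.
lra.
Qed.

(* If [A] maps the complement of [span f] into the ball of radius 1/2, then
   [A *m stretch f l] is admissible and has a larger determinant. *)
Lemma exists_orthogonal_large m (b : 'I_(m + m) -> X) A f l :
    adm b A -> 0 < \det A -> (forall B, adm b B -> \det B < 2 * \det A) ->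
    orthonormal_upto f l -> (l < m)%N ->
  exists u, [/\ nrm u = 1, forall k, (k < l)%N -> dot (f k) u = 0 &
                2^-1 <= `|lc b (mulv A u)|].
Proof.
move=> admA dA maxA fo lm; apply: contrapT => /forallNP nu.
have q0 : 0 <= Num.sqrt 2 :> R by exact: sqrtr_ge0.
have q2 : Num.sqrt 2 ^+ 2 = 2 :> R by rewrite sqr_sqrtr.
have half u : (forall k, (k < l)%N -> dot (f k) u = 0) ->
    `|lc b (mulv A u)| <= 2^-1 * nrm u.
  move=> fu; have [->|u0] := eqVneq u 0.
    by rewrite nrm0 mulr0; apply: le_trans (admA 0) _; rewrite nrm0.
  rewrite {1}(nrm_normalizeK u) mulvZ lcZ normrZ (ger0_norm (nrm_ge0 u)) mulrC.
  rewrite ler_pM2r ?nrm_gt0// leNgt; apply/negP => h.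
  apply: (nu ((nrm u)^-1 *: u)); split; rewrite ?nrm_normalize ?(ltW h)// => k kl.
  by rewrite dotZr fu// mulr0.
have /maxA : adm b (A *m stretch f l).
  move=> t; rewrite mulvM mulv_stretch mulvD !mulvZ lcD !lcZ.
  set p := proj f l t.
  have hp := half (t - p); have {}hp : `|lc b (mulv A (t - p))| <= 2^-1 * nrm (t - p).
    by apply: hp => k kl; rewrite dotBr dot_proj// subrr.
  have hq := admA p.
  apply: le_trans (ler_normD _ _) _; rewrite !normrZ.
  rewrite !ger0_norm ?mulr_ge0 ?invr_ge0//.
  have pyth : nrm (t - p) ^+ 2 + nrm p ^+ 2 = nrm t ^+ 2.
    rewrite !sqr_nrm dotBl !dotBr dot_proj_proj// (dotC t); ring.
  apply: (@le_trans _ _ (Num.sqrt 2 / 2 * (nrm (t - p) + nrm p))).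
    rewrite mulrDr; apply: lerD; last by rewrite ler_wpM2l// mulr_ge0// invr_ge0.
    by rewrite -mulrA ler_wpM2l.
  rewrite -(@ler_pXn2r _ 2)// ?nnegrE ?mulr_ge0 ?addr_ge0 ?nrm_ge0 ?invr_ge0//.
  rewrite exprMn expr_div_n q2 -pyth.
  have := sqr_ge0 (nrm (t - p) - nrm p).
  set x := nrm (t - p); set y := nrm p => h; rewrite -subr_ge0.
  have -> : x ^+ 2 + y ^+ 2 - 2 / 2 ^+ 2 * (x + y) ^+ 2 = 2^-1 * (x - y) ^+ 2.
    by field.
  by rewrite mulr_ge0.
(* In dimension [m + m] the determinant is multiplied by 2^(m - l), which is at least 2 because
   [l < m]. *)
rewrite det_mulmx det_stretch// exprD -exprMn -expr2 q2.
apply/negP; rewrite -leNgt mulrC ler_pM2l// -(subnKC lm) exprD exprS.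
have -> : 2 * 2 ^+ l * 2 ^+ (m - l.+1) * 2^-1 ^+ l = 2 * 2 ^+ (m - l.+1) :> R.
  by rewrite exprVn; field; rewrite expf_neq0.
by rewrite ler_peMr// exprn_ege1// ler1n.
Qed.

(** Orthonormal vectors with images of norm at least 1/2 are chosen greedily in dimension [m + m].
    The upper bound is admissibility, since an orthonormal combination has Euclidean norm
    [nrm t]. *)
Theorem dvoretzky_rogers m : infinite_dimensional X -> exists x : 'I_m -> X,
  (forall i, 2^-1 <= `|x i|) /\ (forall t, `|lc x t| <= nrm t).
Proof.
move=> infX; have [b bI] := exists_lin_indep (m + m) infX.
have [A admA [dA maxA]] := exists_near_max_det bI.
have [f [fo fA]] : exists f : nat -> 'I_(m + m) -> R, orthonormal_upto f m /\
    forall k, (k < m)%N -> 2^-1 <= `|lc b (mulv A (f k))|.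
  suff : forall l, (l <= m)%N -> exists f : nat -> 'I_(m + m) -> R,
      orthonormal_upto f l /\
      forall k, (k < l)%N -> 2^-1 <= `|lc b (mulv A (f k))| by apply.
  elim=> [_|l IH lm]; first by exists (fun=> 0).
  have [f [fo fA]] := IH (ltnW lm).
  have [u [u1 fu uA]] := exists_orthogonal_large admA dA maxA fo lm.
  have uu : dot u u = 1 by rewrite -sqr_nrm u1 expr1n.
  exists (fun k => if k == l then u else f k); split=> [i j|k].
    rewrite !ltnS (leq_eqVlt i) (leq_eqVlt j) => /orP[/eqP->|il] /orP[/eqP->|jl].
    - by rewrite eqxx uu.
    - by rewrite eqxx (ltn_eqF jl) (gtn_eqF jl) dotC fu.
    - by rewrite eqxx (ltn_eqF il) fu.
    - by rewrite (ltn_eqF il) (ltn_eqF jl) fo.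
  by rewrite ltnS leq_eqVlt => /orP[/eqP->|kl]; rewrite ?eqxx ?(ltn_eqF kl)//; exact: fA.
exists (fun k : 'I_m => lc b (mulv A (f k))); split=> [k|t]; first exact: fA.
pose u : 'I_(m + m) -> R := \sum_(k < m) t k *: f k.
have -> : lc (fun k : 'I_m => lc b (mulv A (f k))) t = lc b (mulv A u).
  rewrite [LHS]/lc /u; elim/big_rec2: _ => [|k x y _ ->].
    have m0 : mulv A 0 = 0 by rewrite -[in LHS](scale0r 0) mulvZ scale0r.
    by rewrite m0 lc0.
  by rewrite mulvD mulvZ lcD lcZ.
apply: le_trans (admA u) _; rewrite le_eqVlt; apply/orP; left; apply/eqP.
congr Num.sqrt; have dot_sum (F : 'I_m -> 'I_(m + m) -> R) x :
    dot (\sum_i F i) x = \sum_i dot (F i) x.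
  elim/big_rec2: _ => [|i c d _ <-]; first by rewrite dot0l.
  by rewrite dotDl.
rewrite /u dot_sum; apply: eq_bigr => k _; rewrite dotZl; congr (_ * _).
rewrite dotC dot_sum (bigD1 k)//= big1 => [|j jk].
  by rewrite dotZl fo// eqxx mulr1 addr0.
have /negPf jk' : (j : nat) != k := jk.
by rewrite dotZl fo// jk' mulr0.
Qed.

End DvoretzkyRogers.

(** * The theorems of Dvoretzky and Milman *)

Section LargeBlocks.
Local Close Scope classical_set_scope.
Variables (R : realType) (n Q : nat) (Om : finType) (o0 : Om) (G : {set Om}).
Let cfg := {ffun 'I_n * 'I_Q -> Om}.

(** The blocks are independent, and each lies in [G] with probability (#|G| / #|Om|)^Q;
    distributivity turns the sum of products into a product of sums. *)
Lemma card_no_block_in :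
  (#|[set s : cfg | ~~ [exists j, [forall q, s (j, q) \in G]]]|%:R : R) =
  #|{: cfg}|%:R * (1 - (#|G|%:R / #|Om|%:R) ^+ Q) ^+ n.
Proof.
pose ind (o : Om) : R := (o \in G)%:R.
have N0 : (#|Om|%:R : R) != 0.
  by rewrite pnatr_eq0 -lt0n; apply/card_gt0P; exists o0.
transitivity (\sum_(s : cfg) \prod_j (1 - \prod_q ind (s (j, q)))).
  rewrite -sum1_card natr_sum big_mkcond; apply: eq_bigr => s _ /=.
  rewrite inE negb_exists.
  have indE j : \prod_q ind (s (j, q)) = ([forall q, s (j, q) \in G])%:R.
    case: (boolP [forall q, _]) => [/forallP h|].
      by rewrite big1// => q _; rewrite /ind h.
    by rewrite negb_forall => /existsP[q /negPf hq]; rewrite (bigD1 q)//= /ind hq mul0r.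
  case: (boolP [forall j, _]) => [/forallP h|].
    by rewrite big1// => j _; rewrite indE (negPf (h j)) subr0.
  rewrite negb_forall => /existsP[j]; rewrite negbK => hj.
  by rewrite (bigD1 j)//= indE hj subrr mul0r.
pose h (t : {ffun 'I_n -> {ffun 'I_Q -> Om}}) : cfg := [ffun p => t p.1 p.2].
have hbij : bijective h.
  exists (fun s : cfg => [ffun j => [ffun q => s (j, q)]]).
    by move=> t; apply/ffunP => j; apply/ffunP => q; rewrite !ffunE.
  by move=> s; apply/ffunP => -[j q]; rewrite !ffunE.
rewrite (reindex h) /=; last by apply: onW_bij.
under eq_bigr => t _.
  under eq_bigr => j _ do under eq_bigr => q _ do rewrite ffunE /=.
  over.
rewrite -(bigA_distr_bigA (fun j (r : {ffun 'I_Q -> Om}) => 1 - \prod_q ind (r q))).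
rewrite prodr_const card_ord sumrB -(bigA_distr_bigA (fun q o => ind o)) /=.
rewrite prodr_const card_ord sumr_const card_ffun card_ord.
have -> : \sum_o ind o = #|G|%:R.
  rewrite -sum1_card natr_sum [RHS]big_mkcond; apply: eq_bigr => o _.
  by rewrite /ind; case: (o \in G).
rewrite card_ffun card_prod !card_ord mulnC expnM natrX natrX -exprMn.
by congr (_ ^+ _); rewrite mulrBr mulr1 expr_div_n mulrC divfK// expf_neq0.
Qed.

End LargeBlocks.

(** * A lower bound for the mean norm of a random combination *)

Section MeanLowerBound.
Local Close Scope classical_set_scope.
Variables (R : realType) (I Om : finType) (o0 : Om) (f : Om -> I -> R).
Variables (neg : Om -> Om) (d : R).
Hypothesis invf : almost_invariant f neg d.

Definition cap (c : R) (a : I -> R) : {set Om} := [set o | c <= dot a (f o)].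

(** Some coordinate has mean square at least 1/k. Values below [c] in absolute value contribute at
    most c^2 <= 1/(4k); the others, of square at most 1, lie in the cap or its opposite, which has
    equal size by symmetry. *)
Lemma exists_large_cap (i0 : I) : let k : R := #|I|%:R in
  exists2 a, nrm a = 1 & (4 * k)^-1 <= #|cap (2 * k)^-1 a|%:R / #|Om|%:R.
Proof.
move=> k; case: invf => f1 fneg negK _.
have k1 : 1 <= k by rewrite ler1n; apply/card_gt0P; exists i0.
have k0 : 0 < k by lra.
have N0 : 0 < (#|Om|%:R : R) by rewrite ltr0n; apply/card_gt0P; exists o0.
set N : R := #|Om|%:R in N0 *.
have [i hi] : exists i, N / k <= \sum_o f o i ^+ 2.
  apply: contrapT => /forallNP h.
  suff : \sum_i \sum_o f o i ^+ 2 < \sum_(i : I) N / k.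
    rewrite exchange_big sumr_const -mulr_natr divfK ?gt_eqF//=.
    have -> : \sum_o \sum_i f o i ^+ 2 = N; last by rewrite ltxx.
    transitivity (\sum_(o : Om) (1 : R)); last by rewrite sumr_const.
    by apply: eq_bigr => o _; rewrite -[RHS](expr1n _ 2) -(f1 o) sqr_nrm.
  apply: ltr_sum => [|i _]; last by rewrite ltNge; apply/negP.
  by apply/hasP; exists i0; rewrite ?mem_index_enum.
exists (unitv i); first exact: nrm_unitv.
set c := (2 * k)^-1; pose g : R := #|cap c (unitv i)|%:R.
have c0 : 0 < c by rewrite invr_gt0 mulr_gt0.
have capE o : (o \in cap c (unitv i)) = (c <= f o i) by rewrite inE dotC dot_unitv.
have capN : #|[set o | c <= - f o i]|%:R = g.
  congr (_%:R); rewrite -(card_imset _ (inv_inj negK)); apply: eq_card => o.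
  apply/imsetP/idP; [case=> o' o'c ->|move=> oc].
    by move: o'c; rewrite inE capE fneg.
  exists (neg o); last by rewrite negK.
  by move: oc; rewrite capE inE fneg -[(- f o) i]/(- f o i) opprK.
have f2 o : f o i ^+ 2 <= 1.
  rewrite -real_normK ?num_real// -[leRHS](expr1n _ 2) ler_pXn2r ?nnegrE//.
  by rewrite -(f1 o) coord_le_nrm.
have hsum : \sum_o f o i ^+ 2 <= N * c ^+ 2 + g + g.
  rewrite -[X in _ + X]capN /g -!sum1_card !natr_sum mulr_natl -sumr_const.
  rewrite [X in _ + X + _]big_mkcond [X in _ + _ + X]big_mkcond -!big_split /=.
  apply: ler_sum => o _; rewrite capE inE.
  have cc : 0 <= c ^+ 2 by exact: sqr_ge0.
  have := f2 o; case: (lerP c (f o i)) => h1; case: (lerP c (- f o i)) => h2 //=; try lra.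
  rewrite !addr0 => _; rewrite -[f o i ^+ 2]real_normK ?num_real//.
  by rewrite ler_pXn2r ?nnegrE ?normr_ge0 ?(ltW c0)// ler_norml; lra.
rewrite ler_pdivlMr// -/g.
have ck : N * c ^+ 2 <= N / k / 4.
  rewrite -!mulrA ler_pM2l// /c expr2 -invfM -invfM lef_pV2 ?posrE ?mulr_gt0//.
  nra.
have -> : (4 * k)^-1 * N = N / k / 4 by field; rewrite gt_eqF.
have : 0 < N / k by rewrite divr_gt0.
lra.
Qed.

Variables (n Q : nat) (X : normedModType R) (x : 'I_n -> X).

(* The sign of the first block with a large sum is flipped: one of the two
   samples gives at least the norm of that block. *)
Lemma mean_block_ge (c : R) a : 0 <= c -> (forall j, 2^-1 <= `|x j|) ->
    #|{: {ffun 'I_n * 'I_Q -> Om}}|%:R / 2 <=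
    #|[set s : {ffun 'I_n * 'I_Q -> Om} |
         [exists j, [forall q, s (j, q) \in cap c a]]]|%:R :> R ->
  c * Q%:R / 4 <=
  mean (fun s : {ffun 'I_n * 'I_Q -> Om} =>
          `|lc (fun p => x p.1) (rowmap (sample f s) a)|).
Proof.
move=> c0 x2 hE; case: invf => f1 fneg negK _.
pose cfg := {ffun 'I_n * 'I_Q -> Om}.
pose F (s : cfg) : R := `|lc (fun p => x p.1) (rowmap (sample f s) a)|.
pose S (s : cfg) j : R := \sum_q dot a (f (s (j, q))).
have FE s : F s = `|\sum_j S s j *: x j|.
  rewrite /F /lc /S; under [in RHS]eq_bigr => j _ do rewrite scaler_suml.
  by rewrite pair_big /=; congr Num.norm; apply: eq_bigr => -[j q].
pose B : {set cfg} := [set s | [exists j, c * Q%:R <= `|S s j|]].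
(* [first] depends only on the absolute values of the block sums, which [flip] preserves; hence
   [flip] is an involution, and it preserves [B]. *)
pose first s := [pick j | c * Q%:R <= `|S s j|].
pose flip s : cfg := if first s is Some j
  then [ffun p => if p.1 == j then neg (s p) else s p] else s.
have Sflip s j : S (flip s) j = if first s == Some j then - S s j else S s j.
  rewrite /flip; case: (first s) => [j'|]; last by [].
  rewrite /S (inj_eq (@Some_inj _)) eq_sym; case: eqVneq => [->|jj].
    rewrite -sumrN; apply: eq_bigr => q _.
    by rewrite ffunE /= eqxx fneg dotNr.
  by apply: eq_bigr => q _; rewrite ffunE /= (negPf jj).
have Snorm s j : `|S (flip s) j| = `|S s j|.
  by rewrite Sflip; case: ifP; rewrite ?normrN.
have firstflip s : first (flip s) = first s.
  by apply: eq_pick => j; rewrite /= Snorm.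
have flipK : involutive flip.
  move=> s; rewrite {1}/flip firstflip /flip; case: (first s) => // j.
  by apply/ffunP => p; rewrite !ffunE; case: eqP => //; rewrite negK.
have Bflip s : (flip s \in B) = (s \in B).
  by rewrite !inE; apply: eq_existsb => j; rewrite Snorm.
have pairB s : s \in B -> c * Q%:R <= F s + F (flip s).
  rewrite inE => /existsP[j1 hj1].
  have [j [fj hj]] : exists j, first s = Some j /\ c * Q%:R <= `|S s j|.
    by rewrite /first; case: pickP => [j hj|/(_ j1)]; [exists j|rewrite hj1].
  rewrite !FE (bigD1 j)//= [X in _ + `|X|](bigD1 j)//= Sflip fj eqxx.
  have -> : \sum_(i | i != j) S (flip s) i *: x i = \sum_(i | i != j) S s i *: x i.
    by apply: eq_bigr => i ij; rewrite Sflip fj (inj_eq (@Some_inj _)) eq_sym (negPf ij).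
  set z := \sum_(i | _) _; rewrite scaleNr.
  (* The other blocks contribute the same [z] to both samples and cancel in the difference. *)
  have : `|S s j *: x j *+ 2| <= `|S s j *: x j + z| + `|- (S s j *: x j) + z|.
    have -> : S s j *: x j *+ 2 = (S s j *: x j + z) - (- (S s j *: x j) + z).
      by rewrite opprD opprK addrACA subrr addr0 mulr2n.
    exact: ler_normB.
  apply: le_trans; rewrite normrMn normrZ -mulrnAr.
  apply: le_trans hj _; rewrite ler_peMr// -mulr_natr.
  have := x2 j; lra.
have N0 := card_cfg_gt0 R ('I_n * 'I_Q)%type o0.
have FB : c * Q%:R * #|B|%:R <= 2 * \sum_(s in B) F s.
  have -> : 2 * \sum_(s in B) F s = \sum_(s in B) (F s + F (flip s)).
    rewrite big_split /= mulr_natl mulr2n; congr (_ + _).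
    rewrite [LHS](reindex_inj (inv_inj flipK)) /=.
    by apply: eq_bigl => s; rewrite Bflip.
  by rewrite mulr_natr -sumr_const; apply: ler_sum.
have EB : #|{: cfg}|%:R / 2 <= #|B|%:R :> R.
  apply: le_trans hE _; rewrite ler_nat; apply/subset_leq_card/fintype.subsetP => s.
  rewrite !inE => /existsP[j /forallP hj]; apply/existsP; exists j.
  apply: le_trans (ler_norm _).
  have -> : c * Q%:R = \sum_(q < Q) c by rewrite sumr_const card_ord mulr_natr.
  by apply: ler_sum => q _; have := hj q; rewrite inE.
have FT : \sum_(s in B) F s <= \sum_s F s.
  rewrite [leRHS](bigID (mem B)) /= lerDl; apply: sumr_ge0 => s _.
  exact: normr_ge0.
rewrite /mean ler_pdivlMl//.
have : c * Q%:R * (#|{: cfg}|%:R / 2) <= c * Q%:R * #|B|%:R.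
  by rewrite ler_wpM2l// mulr_ge0.
rewrite -/F; lra.
Qed.

End MeanLowerBound.

(** * From a net of the sphere to all vectors *)

Section Seminorms.
Variables (R : realType) (I : finType) (p : (I -> R) -> R).
Hypothesis pD : forall x y, p (x + y) <= p x + p y.
Hypothesis pZ : forall (t : R) x, p (t *: x) = `|t| * p x.

Lemma seminorm0 : p 0 = 0.
Proof. by rewrite -[X in p X](scale0r (0 : I -> R)) pZ normr0 mul0r. Qed.

Lemma seminormBC x y : p (x - y) = p (y - x).
Proof. by rewrite -opprB -scaleN1r pZ normrN1 mul1r. Qed.

Lemma seminormB x y : `|p x - p y| <= p (x - y).
Proof.
have h u v : p u - p v <= p (u - v).
  by rewrite lerBlDr; apply: le_trans (pD _ _); rewrite subrK.
by rewrite ler_norml h andbT lerNl opprB seminormBC h.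
Qed.

Lemma seminorm_coord x : p x <= \sum_i `|x i| * p (unitv i).
Proof.
have {1}-> : x = \sum_i x i *: unitv i.
  apply/funext => j; rewrite fct_sumE (bigD1 j)//= big1 => [|i ij].
    by rewrite addr0 -[RHS]/(x j * (j == j)%:R) eqxx mulr1.
  by rewrite -[LHS]/(x i * (j == i)%:R) eq_sym (negPf ij) mulr0.
elim/big_rec2: _ => [|i a b _ h]; first by rewrite seminorm0.
by apply: le_trans (pD _ _) _; rewrite pZ lerD2l.
Qed.

Lemma seminorm_bound (c : R) x : 0 <= c -> (forall i, p (unitv i) <= c) ->
  p x <= #|I|%:R * c * nrm x.
Proof.
move=> c0 h; apply: le_trans (seminorm_coord x) _.
rewrite -mulrA mulr_natl -sumr_const; apply: ler_sum => i _; rewrite mulrC.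
have := h i; have := coord_le_nrm x i => h1 h2.
apply: (@le_trans _ _ (c * `|x i|)); first by rewrite ler_wpM2r.
by rewrite ler_wpM2l.
Qed.

(** The values on the basis give the Lipschitz constant [2 * c * #|I|], so the mesh [th] costs at
    most [c * eps / 2] between net points. *)
Lemma seminorm_net n (w : 'I_n -> I -> R) (c eps th : R) :
    0 <= c -> sphere_net w th -> (forall i, p (unitv i) <= 2 * c) ->
    (forall i, `|p (w i) - c| <= c * eps / 2) -> 2 * #|I|%:R * th <= eps / 2 ->
  forall x, `|p x - c * nrm x| <= c * eps * nrm x.
Proof.
move=> c0 [w1 wn] pu pw hth x; have [->|x0] := eqVneq x 0.
  by rewrite seminorm0 nrm0 !mulr0 subr0 normr0.
set y := (nrm x)^-1 *: x; have y1 : nrm y = 1 by exact: nrm_normalize.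
rewrite (nrm_normalizeK x) -/y pZ nrmZ y1 mulr1 (ger0_norm (nrm_ge0 x)).
rewrite [c * _]mulrC -mulrBr normrM ger0_norm ?nrm_ge0// mulrC.
rewrite ler_pM2r ?nrm_gt0//; have [i yi] := wn y y1.
have -> : p y - c = (p y - p (w i)) + (p (w i) - c) by rewrite addrA subrK.
apply: le_trans (ler_normD _ _) _.
have h1 : `|p y - p (w i)| <= #|I|%:R * (2 * c) * th.
  apply: le_trans (seminormB _ _) _.
  apply: le_trans (seminorm_bound _ _ pu) _; first by rewrite mulr_ge0.
  by rewrite ler_wpM2l// !mulr_ge0.
have := pw i; have := ler_wpM2l c0 hth; lra.
Qed.

End Seminorms.

(** * Random matrices followed by a map into [X], and Dvoretzky's theorem *)

Section LcSeminorm.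
Variables (R : realType) (X : normedModType R).

(** The images of the standard basis vectors under the matrix [v] followed by [lc x]. *)
Definition lcomp (I J : finType) (x : J -> X) (v : J -> I -> R) : I -> X :=
  fun i => \sum_j v j i *: x j.

Lemma lc_lcomp (I J : finType) (x : J -> X) (v : J -> I -> R) a :
  lc (lcomp x v) a = lc x (rowmap v a).
Proof.
rewrite /lc /lcomp; under eq_bigr do rewrite scaler_sumr.
rewrite exchange_big; apply: eq_bigr => j _ /=; rewrite scaler_suml.
by apply: eq_bigr => i _; rewrite scalerA.
Qed.

Lemma norm_lcD (I : finType) (v : I -> X) x y :
  `|lc v (x + y)| <= `|lc v x| + `|lc v y|.
Proof. by rewrite lcD ler_normD. Qed.

Lemma norm_lcZ (I : finType) (v : I -> X) (t : R) x :
  `|lc v (t *: x)| = `|t| * `|lc v x|.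
Proof. by rewrite lcZ normrZ. Qed.

Lemma conv_lip_norm_lc (J : finType) (v : J -> X) (u : X) (s w : R) :
    (forall x, `|s| * `|lc v x| <= w * nrm x) ->
  conv_lip w (fun x => `|u + s *: lc v x|).
Proof.
move=> h; split=> [x y t /andP[t0 t1]|x y].
  have -> : u + s *: lc v (t *: x + (1 - t) *: y) =
      t *: (u + s *: lc v x) + (1 - t) *: (u + s *: lc v y).
    rewrite !scalerDr addrACA -scalerDl [t + _]addrC subrK scale1r lcD !lcZ scalerDr.
    by rewrite !scalerA ![s * _]mulrC.
  apply: le_trans (ler_normD _ _) _.
  by rewrite !normrZ !ger0_norm// subr_ge0.
apply: le_trans (ler_dist_dist _ _) _.
by rewrite opprD addrACA subrr add0r -scalerBr -lcB normrZ.
Qed.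

(** Cauchy-Schwarz in each block: repeating every vector [Q] times multiplies the Lipschitz constant
    only by the square root of [Q], whereas the mean grows like [Q]. *)
Lemma norm_lc_blocks n Q (x : 'I_n -> X) (y : 'I_n * 'I_Q -> R) :
    (forall t, `|lc x t| <= nrm t) ->
  `|lc (fun q : 'I_n * 'I_Q => x q.1) y| <= Num.sqrt Q%:R * nrm y.
Proof.
move=> hx; pose t j := \sum_q y (j, q).
have -> : lc (fun q : 'I_n * 'I_Q => x q.1) y = lc x t.
  rewrite /lc /t; under [in RHS]eq_bigr => j _ do rewrite scaler_suml.
  by rewrite pair_big /=; apply: eq_bigr => -[j q].
apply: le_trans (hx t) _.
rewrite -(@ler_pXn2r _ 2)// ?nnegrE ?mulr_ge0 ?sqrtr_ge0 ?nrm_ge0//.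
rewrite exprMn (sqr_sqrtr (ler0n R Q)) !sqr_nrm /dot mulr_sumr.
have -> : \sum_q Q%:R * (y q * y q) = \sum_j \sum_q Q%:R * (y (j, q) * y (j, q)).
  by rewrite pair_big /=; apply: eq_bigr => -[j q].
apply: ler_sum => j _; rewrite -mulr_sumr -expr2.
pose one : 'I_Q -> R := fun=> 1; pose z : 'I_Q -> R := fun q => y (j, q).
have -> : t j = dot one z by apply: eq_bigr => q _; rewrite mul1r.
have -> : Q%:R = dot one one.
  by rewrite /dot; under eq_bigr do rewrite mulr1; rewrite sumr_const card_ord.
rewrite [leRHS](_ : _ = (nrm one * nrm z) ^+ 2); last by rewrite exprMn !sqr_nrm.
rewrite -real_normK ?num_real//.
by rewrite ler_pXn2r ?nnegrE ?mulr_ge0 ?nrm_ge0// norm_dot_le.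
Qed.

(** A random matrix is composed with the Dvoretzky-Rogers vectors, each repeated [Q] times. The norm
    concentrates near its mean on a net and on the basis, and dividing by the mean gives an almost
    isometry. *)
Theorem dvoretzky k (eps : R) : 0 < eps -> infinite_dimensional X ->
  exists u : 'I_k.+1 -> X, forall a, `| `|lc u a| - nrm a| <= eps * nrm a.
Proof.
move=> eps0 infX; pose I : finType := 'I_k.+1; pose K : R := k.+1%:R.
have K1 : 1 <= K by rewrite ler1n.
pose th := Num.min (eps / (8 * K)) 1.
have K0 : 0 < K by lra.
have th0 : 0 < th by rewrite lt_min ltr01 divr_gt0// mulr_gt0.
have [n [w wn]] := exists_sphere_net I th0.
pose A : finType := ('I_n + I)%type.
pose pt (z : A) : I -> R := match z with inl i => w i | inr i => unitv i end.
have pt1 z : nrm (pt z) = 1 by case: z => i; [exact: wn.1|exact: nrm_unitv].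
pose e := Num.min (eps / 2) 1; have e0 : 0 < e by rewrite lt_min ltr01 divr_gt0.
have [ee e1] : e <= eps / 2 /\ e <= 1 by split; rewrite ge_min lexx ?orbT.
(* In units of the Lipschitz constant, the first term is the deviation from the mean and the second
   the variation of the mean over the sphere. *)
pose C : R := 2 * Num.sqrt #|A|%:R + 1.
have C1 : 1 <= C by rewrite lerDr mulr_ge0.
pose c := (2 * K)^-1; have c0 : 0 < c by rewrite invr_gt0 mulr_gt0.
pose pc := (4 * K)^-1; have pc0 : 0 < pc by rewrite invr_gt0 mulr_gt0.
(* [Q] beats the deviations, then [m] makes a large block likely. *)
pose q := (C * 8 / (c * e)) ^+ 2.
pose Q := (Num.truncn q).+1.
have qQ : C * 8 / (c * e) <= Num.sqrt Q%:R.
  rewrite -[leLHS]ger0_norm; last by rewrite divr_ge0// ?mulr_ge0//; lra.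
  by rewrite -sqrtr_sqr ler_sqrt ?ltr0n// ltW// truncnS_gt.
have [m hm] : exists m, (1 - pc ^+ Q) ^+ m <= 2^-1 :> R.
  have pQ1 : pc ^+ Q <= 1.
    by rewrite exprn_ile1 ?(ltW pc0)// /pc invf_le1; lra.
  have pQ0 : 0 < pc ^+ Q by rewrite exprn_gt0.
  move: (pc ^+ Q) pQ1 pQ0 => t t1 t0.
  have /cvgr0_norm_le /(_ 2^-1) [] : (fun m => (1 - t) ^+ m) @ \oo --> 0.
    by apply: cvg_expr; rewrite ger0_norm; lra.
  - by rewrite invr_gt0.
  move=> m _ hm; exists m; have := hm m (leqnn m).
  by apply: le_trans; exact: ler_norm.
have [x [x2 xn]] := dvoretzky_rogers m infX.
pose J : finType := ('I_m * 'I_Q)%type.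
(* With this tolerance the means at two unit vectors differ by at most the Lipschitz constant. *)
pose d : R := (Num.sqrt #|J|%:R + 1)^-1.
have sJ : 0 <= Num.sqrt #|J|%:R :> R by exact: sqrtr_ge0.
have d0 : 0 < d by rewrite invr_gt0; lra.
have [Om [ o0 [f [neg invf]]]] := exists_almost_invariant (ord0 : I) d0.
have [a0 a01 capa0] := exists_large_cap o0 invf (ord0 : I).
pose x' (j : J) := x j.1.
pose g y := `|lc x' y|.
pose W := Num.sqrt Q%:R : R; have W0 : 0 <= W by exact: sqrtr_ge0.
have cg : conv_lip W g.
  have -> : g = fun y => `|0 + (1 : R) *: lc x' y|.
    by apply/funext => y; rewrite add0r scale1r.
  by apply: conv_lip_norm_lc => y; rewrite normr1 mul1r; exact: norm_lc_blocks.
have [s hs] := concentration o0 invf (g := fun _ : unit => g) W0 (fun=> cg) pt1.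
pose mu a := mean (fun s : {ffun J -> Om} => g (rowmap (sample f s) a)).
have mu0 : c * Q%:R / 4 <= mu a0.
  apply: (@mean_block_ge _ _ _ o0 f neg d invf m Q X x c a0 (ltW c0) x2).
  set P := [set s : {ffun 'I_m * 'I_Q -> Om} | _]%SET.
  have cP : #|P|%:R + #|~: P|%:R = #|{: {ffun 'I_m * 'I_Q -> Om}}|%:R :> R.
    by rewrite -natrD cardsC.
  have N0 := card_cfg_gt0 R ('I_m * 'I_Q)%type o0.
  suff : #|~: P|%:R <= #|{: {ffun 'I_m * 'I_Q -> Om}}|%:R * 2^-1 :> R by lra.
  have -> : ~: P = [set s : {ffun 'I_m * 'I_Q -> Om} |
      ~~ [exists j, [forall q, s (j, q) \in cap f c a0]]]%SET.
    by apply/finset.setP => s'; rewrite !inE.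
  rewrite (card_no_block_in R m Q o0) ler_pM2l//; apply: le_trans hm.
  rewrite card_ord -/K -/c -/pc in capa0.
  have g1 : #|cap f c a0|%:R / #|Om|%:R <= 1 :> R.
    rewrite ler_pdivrMr ?mul1r ?ler_nat ?max_card// ltr0n.
    by apply/card_gt0P; exists o0.
  have {capa0} h1 : pc ^+ Q <= (#|cap f c a0|%:R / #|Om|%:R) ^+ Q.
    by apply: lerXn2r => //; rewrite nnegrE ?divr_ge0// ltW.
  have h2 : (#|cap f c a0|%:R / #|Om|%:R) ^+ Q <= 1 :> R.
    by rewrite exprn_ile1// divr_ge0.
  apply: lerXn2r; rewrite ?nnegrE; last by rewrite lerD2l lerN2.
    by rewrite subr_ge0.
  by rewrite subr_ge0; exact: le_trans h1 h2.
have near z : `|g (rowmap (sample f s) (pt z)) - mu a0| <= W * C.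
  have -> : g (rowmap (sample f s) (pt z)) - mu a0 =
      (g (rowmap (sample f s) (pt z)) - mu (pt z)) + (mu (pt z) - mu a0).
    by rewrite addrA subrK.
  apply: le_trans (ler_normD _ _) _.
  have := hs tt z; rewrite card_unit mul1n.
  have := mean_row_near o0 invf W0 cg (pt1 z) a01.
  have : d * Num.sqrt #|J|%:R <= 1 by rewrite /d mulrC ler_pdivrMr; lra.
  move=> /(ler_wpM2l W0); rewrite /C /mu; lra.
have WC : W * C <= mu a0 * (e / 2).
  have h1 : C * 8 <= W * (c * e) by rewrite -ler_pdivrMr// mulr_gt0.
  have := ler_wpM2l W0 h1; rewrite [W * (W * _)]mulrA -expr2 sqr_sqrtr//.
  have := ler_wpM2r (ltW e0) mu0; lra.
have mup : 0 < mu a0 by apply: lt_le_trans mu0; rewrite divr_gt0// mulr_gt0// ltr0n.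
pose u0 := lcomp x' (sample f s).
have u0E a : `|lc u0 a| = g (rowmap (sample f s) a) by rewrite lc_lcomp.
have h0 := seminorm_net (norm_lcD u0) (norm_lcZ u0) (ltW mup) wn (eps := eps).
have {}h0 a : `| `|lc u0 a| - mu a0 * nrm a| <= mu a0 * eps * nrm a.
  apply: h0 => [i|i|].
  - rewrite u0E; have := near (inr i); rewrite ler_norml /=.
    have : mu a0 * (e / 2) <= mu a0 by rewrite ger_pMr//; lra.
    lra.
  - rewrite u0E; apply: le_trans (near (inl i)) _; apply: le_trans WC _.
    by rewrite -mulrA ler_pM2l//; lra.
  - rewrite card_ord -/K; have : th <= eps / (8 * K) by rewrite ge_min lexx.
    have -> : eps / (8 * K) = (eps / 8) / K by field; rewrite gt_eqF.
    by rewrite ler_pdivlMr//; lra.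
exists (fun i => (mu a0)^-1 *: u0 i) => a.
have -> : lc (fun i => (mu a0)^-1 *: u0 i) a = (mu a0)^-1 *: lc u0 a.
  by rewrite /lc scaler_sumr; apply: eq_bigr => i _; rewrite !scalerA mulrC.
rewrite normrZ ger0_norm ?invr_ge0 ?(ltW mup)// -(ler_pM2l mup).
apply: le_trans (le_trans _ (h0 a)) _; last by rewrite mulrA.
rewrite -[X in X * _](ger0_norm (ltW mup)) -normrM mulrBr.
by rewrite mulVKf// gt_eqF.
Qed.

End LcSeminorm.

(** * Milman's theorem for finitely many convex Lipschitz functions *)

Section Milman.
Variable R : realType.

Lemma conv_lip_scale (J : finType) (w t : R) (g : (J -> R) -> R) :
  0 <= t -> conv_lip w g -> conv_lip (w * t) (fun y => g (t *: y)).
Proof.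
move=> t0 [gc gl]; split=> [x y s s01|x y].
  have -> : t *: (s *: x + (1 - s) *: y) = s *: (t *: x) + (1 - s) *: (t *: y).
    by rewrite scalerDr !scalerA ![t * _]mulrC.
  exact: gc.
by apply: le_trans (gl _ _) _; rewrite -scalerBr nrmZ ger0_norm// mulrA.
Qed.

Lemma conv_lip_nrm (J : finType) (w : R) : 1 <= w -> conv_lip w (@nrm R J).
Proof.
move=> w1; split=> [x y t /andP[t0 t1]|x y].
  by apply: le_trans (nrmD _ _) _; rewrite !nrmZ !ger0_norm// subr_ge0.
apply: le_trans (nrmB_norm _ _) _; by rewrite ler_peMl// nrm_ge0.
Qed.

Lemma rowmapD (I J : finType) (v : J -> I -> R) a b :
  rowmap v (a + b) = rowmap v a + rowmap v b.
Proof. by apply/funext => j; exact: dotDl. Qed.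

Lemma rowmapZ (I J : finType) (v : J -> I -> R) (t : R) a :
  rowmap v (t *: a) = t *: rowmap v a.
Proof. by apply/funext => j; exact: dotZl. Qed.

Lemma rowmapB (I J : finType) (v : J -> I -> R) a b :
  rowmap v (a - b) = rowmap v a - rowmap v b.
Proof. by rewrite rowmapD -scaleN1r rowmapZ scaleN1r. Qed.

(** For unit rows, the squared norms of the columns add up to the number of rows. This makes the
    mean norm of the image of some basis vector large. *)
Lemma sqrt_card_le_sum_nrm (I J : finType) (v : J -> I -> R) :
  (forall j, nrm (v j) = 1) ->
  Num.sqrt #|J|%:R <= \sum_i nrm (rowmap v (unitv i)).
Proof.
move=> v1; have s0 : 0 <= \sum_i nrm (rowmap v (unitv i)).
  by apply: sumr_ge0 => i _; exact: nrm_ge0.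
rewrite -(@ler_pXn2r _ 2)// ?nnegrE ?sqrtr_ge0// sqr_sqrtr//.
have -> : #|J|%:R = \sum_i nrm (rowmap v (unitv i)) ^+ 2 :> R.
  under eq_bigr do rewrite sqr_nrm.
  rewrite exchange_big /= -[LHS]mulr1 mulr_natl -sumr_const.
  apply: eq_bigr => j _; rewrite -[LHS](expr1n _ 2) -(v1 j) sqr_nrm.
  by apply: eq_bigr => i _; rewrite /rowmap dotC dot_unitv.
rewrite expr2 mulr_suml; apply: ler_sum => i _; rewrite expr2.
rewrite ler_wpM2l ?nrm_ge0// (bigD1 i)//= lerDl.
by apply: sumr_ge0 => *; exact: nrm_ge0.
Qed.

(** A random matrix divided by the mean norm [c0] of the image of a basis vector: since [c0] grows
    with [L], the rescaled functions have small Lipschitz constants and concentrate. [L] depends on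
    the number of functions but not on the functions. *)
Theorem milman k q (eps : R) : 0 < eps -> exists L : nat,
  forall (G : finType) (g : G -> ('I_L.+1 -> R) -> R), #|G| = q ->
    (forall c, conv_lip 2 (g c)) ->
  exists v : 'I_L.+1 -> 'I_k.+1 -> R,
    (forall a, `|nrm (rowmap v a) - nrm a| <= eps * nrm a) /\
    (forall c a b, nrm a = 1 -> nrm b = 1 ->
       `|g c (rowmap v a) - g c (rowmap v b)| <= eps).
Proof.
move=> eps0; pose I : finType := 'I_k.+1; pose K : R := k.+1%:R.
have K1 : 1 <= K by rewrite ler1n.
pose e := Num.min eps 1; have e0 : 0 < e by rewrite lt_min ltr01 eps0.
have [ee e1] : e <= eps /\ e <= 1 by split; rewrite ge_min lexx ?orbT.
pose th := e / (16 * K).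
have K0 : 0 < K by lra.
have thK : th * K = e / 16 by rewrite /th; field; rewrite gt_eqF.
have th0 : 0 < th by rewrite divr_gt0// mulr_gt0.
have the : th <= e / 16 by rewrite -thK ler_peMr// ltW.
have [n [w wn]] := exists_sphere_net I th0.
pose A : finType := ('I_n + I)%type.
pose pt (z : A) : I -> R := match z with inl i => w i | inr i => unitv i end.
have pt1 z : nrm (pt z) = 1 by case: z => i; [exact: wn.1|exact: nrm_unitv].
pose C : R := 2 * Num.sqrt (q.+1 * #|A|)%:R + 1.
have C1 : 1 <= C by rewrite lerDr mulr_ge0.
(* This makes [c0], which is at least the square root of [L.+1] over [K], reach [C * 8 / e]. *)
pose L := Num.truncn ((C * 8 * K / e) ^+ 2); exists L => G g cardG cg.
pose J : finType := 'I_L.+1.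
have qL : C * 8 * K / e <= Num.sqrt L.+1%:R.
  rewrite -[leLHS]ger0_norm; last by rewrite divr_ge0 ?mulr_ge0 ?(ltW e0) ?(ltW K0)//; lra.
  by rewrite -sqrtr_sqr ler_sqrt ?ltr0n// ltW// truncnS_gt.
pose d : R := (Num.sqrt #|J|%:R + 1)^-1.
have sJ : 0 <= Num.sqrt #|J|%:R :> R by exact: sqrtr_ge0.
have d0 : 0 < d by rewrite invr_gt0; lra.
have [Om [ o0 [f [neg invf]]]] := exists_almost_invariant (ord0 : I) d0.
pose nu a := mean (fun s : {ffun J -> Om} => nrm (rowmap (sample f s) a)).
have [i0 c00] : exists i, Num.sqrt L.+1%:R / K <= nu (unitv i).
  apply: contrapT => /forallNP h.
  have N0 := card_cfg_gt0 R J o0.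
  suff : \sum_i nu (unitv i) < \sum_(i : I) Num.sqrt L.+1%:R / K.
    have -> : \sum_(i : I) Num.sqrt L.+1%:R / K = Num.sqrt L.+1%:R.
      by rewrite sumr_const card_ord -(mulr_natr (_ / K)) divfK ?gt_eqF.
    rewrite ltNge => /negP; apply.
    rewrite -mulr_sumr exchange_big /= ler_pdivlMl// mulr_natl -sumr_const.
    apply: ler_sum => s _; rewrite -[L.+1 in leLHS]card_ord.
    by apply: sqrt_card_le_sum_nrm => j; case: invf => f1 _ _ _; exact: f1.
  apply: ltr_sum => [|i _]; last by rewrite ltNge; apply/negP.
  by apply/hasP; exists ord0; rewrite ?mem_index_enum.
set a0 : I -> R := unitv i0 in c00; set c0 := nu a0 in c00.
have a01 : nrm a0 = 1 by exact: nrm_unitv.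
have c0L : C * 8 / e <= c0.
  apply: le_trans c00; rewrite ler_pdivlMr//; apply: le_trans qL.
  by rewrite le_eqVlt; apply/orP; left; apply/eqP; ring.
have c0p : 0 < c0.
  by apply: lt_le_trans c0L; rewrite divr_gt0// mulr_gt0//; lra.
pose W : R := 2 * c0^-1; have W0 : 0 <= W by rewrite mulr_ge0// invr_ge0 ltW.
have WC : W * C <= e / 4.
  rewrite /W mulrAC ler_pdivrMr//; rewrite ler_pdivrMr// in c0L; lra.
(* [None] stands for the Euclidean norm, so that one sample serves both conclusions; hence [q.+1] in
   [C]. *)
pose g' (c : option G) (y : J -> R) :=
  if c is Some c then g c (c0^-1 *: y) else nrm (c0^-1 *: y).
have cg' c : conv_lip W (g' c).
  have c0i : 0 <= c0^-1 by rewrite invr_ge0 ltW.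
  case: c => [c|]; first exact: conv_lip_scale.
  by apply: conv_lip_scale => //; apply: conv_lip_nrm; lra.
have [s hs] := concentration o0 invf W0 cg' pt1.
pose mu c a := mean (fun s : {ffun J -> Om} => g' c (rowmap (sample f s) a)).
have near c z : `|g' c (rowmap (sample f s) (pt z)) - mu c a0| <= e / 4.
  apply: le_trans WC.
  have -> : g' c (rowmap (sample f s) (pt z)) - mu c a0 =
      (g' c (rowmap (sample f s) (pt z)) - mu c (pt z)) + (mu c (pt z) - mu c a0).
    by rewrite addrA subrK.
  apply: le_trans (ler_normD _ _) _.
  have := hs c z; rewrite card_option cardG.
  have := mean_row_near o0 invf W0 (cg' c) (pt1 z) a01.
  have : d * Num.sqrt #|J|%:R <= 1 by rewrite /d mulrC ler_pdivrMr; lra.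
  move=> /(ler_wpM2l W0); rewrite /C /mu; lra.
have muN : mu None a0 = 1.
  rewrite /mu /g' /mean; under eq_bigr => s' _.
    rewrite nrmZ ger0_norm ?invr_ge0 ?(ltW c0p)//; over.
  by rewrite -mulr_sumr mulrCA -/(nu a0) mulVf// gt_eqF.
pose v (j : J) : I -> R := c0^-1 *: sample f s j.
have vE a : rowmap v a = c0^-1 *: rowmap (sample f s) a.
  by apply/funext => j; rewrite /rowmap dotZr.
have hN a : `|nrm (rowmap v a) - nrm a| <= e * nrm a.
  have nD x y : nrm (rowmap v (x + y)) <= nrm (rowmap v x) + nrm (rowmap v y).
    by rewrite rowmapD nrmD.
  have nZ (t : R) x : nrm (rowmap v (t *: x)) = `|t| * nrm (rowmap v x).
    by rewrite rowmapZ nrmZ.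
  have nearN z : `|nrm (rowmap v (pt z)) - 1| <= e / 4.
    by have := near None z; rewrite muN /= -vE.
  have := seminorm_net nD nZ ler01 wn (eps := e) _ _ _ a.
  rewrite !mul1r; apply => [i|i|].
  - by have := nearN (inr i); rewrite ler_norml mulr1 /=; lra.
  - by apply: le_trans (nearN (inl i)) _; lra.
  - by rewrite card_ord -/K; lra.
have lipv a : nrm (rowmap v a) <= 2 * nrm a.
  have := hN a; have := ler_wpM2r (nrm_ge0 a) e1; rewrite ler_norml; lra.
exists v; split=> [a|c a b a1 b1].
  by apply: le_trans (hN a) _; rewrite ler_wpM2r ?nrm_ge0.
have key x : nrm x = 1 -> `|g c (rowmap v x) - mu (Some c) a0| <= e / 2.
  move=> x1; have [i xi] := wn.2 x x1.
  have -> : g c (rowmap v x) - mu (Some c) a0 =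
     (g c (rowmap v x) - g c (rowmap v (w i))) + (g c (rowmap v (w i)) - mu (Some c) a0).
    by rewrite addrA subrK.
  apply: le_trans (ler_normD _ _) _.
  have h1 := near (Some c) (inl i); rewrite /= -vE in h1.
  have h2 := (cg c).2 (rowmap v x) (rowmap v (w i)); rewrite -rowmapB in h2.
  have h3 := lipv (x - w i); lra.
have -> : g c (rowmap v a) - g c (rowmap v b) =
   (g c (rowmap v a) - mu (Some c) a0) - (g c (rowmap v b) - mu (Some c) a0).
  by rewrite opprB addrA subrK.
apply: le_trans (ler_normB _ _) _; have := key a a1; have := key b b1; lra.
Qed.

End Milman.

(** * Gluing *)

Section Chains.
Variables (R : realType) (X : normedModType R).

Definition near_isom k (e : R) (v : 'I_k -> X) : Prop :=
  forall a, `| `|lc v a| - nrm a| <= e * nrm a.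

Definition mix k l (s : R) (v : 'I_k -> X) (v' : 'I_l -> X)
    (x : 'I_k -> R) (y : 'I_l -> R) : X :=
  (1 - s) *: lc v x + s *: lc v' y.

Lemma near_isom_le k (e : R) (v : 'I_k -> X) a : e <= 1 -> near_isom e v ->
  `|lc v a| <= 2 * nrm a.
Proof.
move=> e1 /(_ a); have := ler_wpM2r (nrm_ge0 a) e1; rewrite ler_norml; lra.
Qed.

Lemma norm_mixB k l (s : R) (v : 'I_k -> X) (v' : 'I_l -> X) x x' y y' :
  0 <= s <= 1 ->
  `| `|mix s v v' x y| - `|mix s v v' x' y'| | <=
    `|lc v (x - x')| + `|lc v' (y - y')|.
Proof.
move=> /andP[s0 s1]; apply: le_trans (ler_dist_dist _ _) _.
rewrite /mix opprD addrACA -!scalerBr -!lcB; apply: le_trans (ler_normD _ _) _.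
rewrite !normrZ !ger0_norm ?subr_ge0//.
by apply: lerD; rewrite ler_piMl//; lra.
Qed.

Lemma norm_mix_weight k l (s t : R) (v : 'I_k -> X) (v' : 'I_l -> X) x y :
  `| `|mix s v v' x y| - `|mix t v v' x y| | <= `|s - t| * (`|lc v x| + `|lc v' y|).
Proof.
apply: le_trans (ler_dist_dist _ _) _.
rewrite /mix opprD addrACA -!scalerBl; apply: le_trans (ler_normD _ _) _.
rewrite !normrZ mulrDr lerD2r; have -> : 1 - s - (1 - t) = - (s - t) by ring.
by rewrite normrN.
Qed.

Lemma near_unit k (e : R) (x : 'I_k -> R) : e <= 2^-1 -> `|nrm x - 1| <= e ->
  exists2 x1, nrm x1 = 1 & nrm (x - x1) <= e.
Proof.
move=> e2 xe; have x0 : x != 0.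
  by apply/eqP => x0; move: xe; rewrite x0 nrm0 sub0r normrN normr1; lra.
exists ((nrm x)^-1 *: x); first exact: nrm_normalize.
have n1 := nrm_normalize x0.
rewrite {1}(nrm_normalizeK x) -[X in _ - X]scale1r -scalerBl nrmZ n1 mulr1.
exact: xe.
Qed.

Lemma grid_near N (e s : R) : N.+1%:R^-1 <= e -> 0 <= s <= 1 ->
  exists j : 'I_N.+2, `|s - j%:R / N.+1%:R| <= e.
Proof.
move=> Ne /andP[s0 s1]; have N0 : (0 : R) < N.+1%:R by rewrite ltr0n.
have sN : 0 <= s * N.+1%:R by rewrite mulr_ge0// ltW.
have jN : (Num.truncn (s * N.+1%:R) < N.+2)%N.
  rewrite truncn_lt_nat//; apply: (@le_lt_trans _ _ N.+1%:R).
    by rewrite ler_piMl// ltW.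
  by rewrite ltr_nat.
exists (Ordinal jN) => /=; have /andP[] := truncn_itv sN.
move: (Num.truncn _) => t; rewrite -[t.+1%:R]natr1 => h1 h2.
apply: le_trans Ne; rewrite -(ler_pM2r N0) mulVf ?gt_eqF//.
have -> : `|s - t%:R / N.+1%:R| * N.+1%:R = `|s * N.+1%:R - t%:R|.
  rewrite -[in RHS](divfK (lt0r_neq0 N0) t%:R) -mulrBl normrM.
  by rewrite (ger0_norm (ltW N0)).
by rewrite ler_norml; lra.
Qed.

Hypothesis infX : infinite_dimensional X.

(** The property of [L] that [milman] yields; the chain fixes all dimensions before any map is
    chosen. *)
Definition milman_dim k q (e : R) L : Prop :=
  forall (G : finType) (g : G -> ('I_L.+1 -> R) -> R), #|G| = q ->
    (forall c, conv_lip 2 (g c)) ->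
  exists v : 'I_L.+1 -> 'I_k.+1 -> R,
    (forall a, `|nrm (rowmap v a) - nrm a| <= e * nrm a) /\
    (forall c a b, nrm a = 1 -> nrm b = 1 ->
       `|g c (rowmap v a) - g c (rowmap v b)| <= e).

(* First [y |-> mix s v u z y] is made almost constant for all [z] in a net of the
   sphere, then [x |-> mix s v v' x y0]. *)
Lemma chain_step (e : R) N k L m (v : 'I_L.+1 -> X) :
    0 < e -> e <= 2^-1 -> N.+1%:R^-1 <= e -> milman_dim k N.+2 e L ->
    near_isom e v ->
  exists v' : 'I_m.+1 -> X, near_isom e v' /\
  exists J : 'I_L.+1 -> 'I_k.+1 -> R,
    (forall a, `|nrm (rowmap J a) - nrm a| <= e * nrm a) /\
    (forall s x x' y y', 0 <= s <= 1 ->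
      nrm x = 1 -> nrm x' = 1 -> nrm y = 1 -> nrm y' = 1 ->
      `| `|mix s v v' (rowmap J x) y| - `|mix s v v' (rowmap J x') y'| | <= 31 * e).
Proof.
move=> e0 e2 Ne HL vI; have e40 : 0 < e / 4 by rewrite divr_gt0.
have e1 : e <= 1 by lra.
have [n [z zn]] := exists_sphere_net 'I_L.+1 e0.
(* One function of [y] for each weight of a grid of [0, 1] and each net point [z]. *)
pose G : finType := ('I_N.+2 * 'I_n)%type.
have [L' HL'] := milman m #|G| e40.
have [u uI] := dvoretzky L' e40 infX.
pose sg (j : 'I_N.+2) : R := j%:R / N.+1%:R.
have sg01 j : 0 <= sg j <= 1.
  rewrite /sg divr_ge0//= ler_pdivrMr ?ltr0n// mul1r ler_nat -ltnS.
  exact: ltn_ord.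
have [|J' [J'N J'g]] := HL' G
  (fun c y => `|(1 - sg c.1) *: lc v (z c.2) + sg c.1 *: lc u y|) erefl.
  move=> c; apply: conv_lip_norm_lc => y; have /andP[s0 s1] := sg01 c.1.
  rewrite ger0_norm//; apply: (@le_trans _ _ `|lc u y|); first by rewrite ler_piMl.
  by apply: near_isom_le uI; lra.
pose v' := lcomp u J'; exists v'.
have v'I : near_isom e v'.
  move=> a; rewrite lc_lcomp.
  have -> : `|lc u (rowmap J' a)| - nrm a =
     (`|lc u (rowmap J' a)| - nrm (rowmap J' a)) + (nrm (rowmap J' a) - nrm a).
    by rewrite addrA subrK.
  apply: le_trans (ler_normD _ _) _; have := uI (rowmap J' a); have h := J'N a.
  have h1 : nrm (rowmap J' a) <= 2 * nrm a.
    by have := ler_wpM2r (nrm_ge0 a) e1; move: h; rewrite ler_norml; have := nrm_ge0 a; lra.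
  have := ler_wpM2l (ltW e40) h1; have := mulr_ge0 (ltW e0) (nrm_ge0 a); lra.
split=> //.
pose y0 : 'I_m.+1 -> R := unitv ord0; have y01 : nrm y0 = 1 by exact: nrm_unitv.
have [|J [JN Jg]] := HL 'I_N.+2
  (fun j x => `|sg j *: lc v' y0 + (1 - sg j) *: lc v x|) (card_ord _).
  move=> j; apply: conv_lip_norm_lc => x; have /andP[s0 s1] := sg01 j.
  rewrite ger0_norm ?subr_ge0//; apply: (@le_trans _ _ `|lc v x|).
    by rewrite ler_piMl//; lra.
  exact: near_isom_le vI.
exists J; split=> // s x x' y y' s01 x1 x'1 y1 y'1.
have [j sj] := grid_near Ne s01; rewrite -/(sg j) in sj.
have Jle a : nrm a = 1 -> nrm (rowmap J a) <= 2.
  by move=> a1; have := JN a; rewrite a1 ler_norml; lra.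
(* Moving the weight to the grid costs [6 * e], moving [rowmap J a] to a net point and back [8 * e],
   and replacing [b] by [y0] costs [e / 4]. *)
have side a b : nrm a = 1 -> nrm b = 1 ->
   `| `|mix s v v' (rowmap J a) b| - `|mix (sg j) v v' (rowmap J a) y0| | <= 15 * e.
  move=> a1 b1.
  have := norm_mix_weight s (sg j) v v' (rowmap J a) b.
  have h1 := near_isom_le (rowmap J a) e1 vI; have h2 := near_isom_le b e1 v'I.
  have {h1 h2} : `|lc v (rowmap J a)| + `|lc v' b| <= 6 by have := Jle a a1; lra.
  move=> h3 h4; have {h3 h4} w1 :
      `| `|mix s v v' (rowmap J a) b| - `|mix (sg j) v v' (rowmap J a) b| | <= 6 * e.
    apply: le_trans h4 _; rewrite [6 * e]mulrC.
    by apply: ler_pM => //; rewrite addr_ge0.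
  have [a2 a21 aa2] : exists2 a2, nrm a2 = 1 & nrm (rowmap J a - a2) <= e.
    by apply: near_unit => //; have := JN a; rewrite a1 mulr1.
  have [i ai] := zn.2 a2 a21.
  have az : nrm (rowmap J a - z i) <= 2 * e.
    have -> : rowmap J a - z i = (rowmap J a - a2) + (a2 - z i) by rewrite addrA subrK.
    by apply: le_trans (nrmD _ _) _; lra.
  have lz : `|lc v (rowmap J a - z i)| <= 4 * e.
    by have := near_isom_le (rowmap J a - z i) e1 vI; lra.
  have w2 := norm_mixB v v' (rowmap J a) (z i) b b (sg01 j).
  have w3 := norm_mixB v v' (rowmap J a) (z i) y0 y0 (sg01 j).
  rewrite !subrr !lc0 normr0 addr0 in w2 w3.
  have := J'g (j, i) b y0 b1 y01; rewrite /= -!lc_lcomp -/v' -!/(mix (sg j) v v' _ _).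
  move: w1 w2 w3 lz; rewrite !ler_norml; lra.
have := Jg j x x' x1 x'1; rewrite ![sg j *: _ + _]addrC -!/(mix (sg j) v v' _ y0).
have := side x y x1 y1; have := side x' y' x'1 y'1; rewrite !ler_norml; lra.
Qed.

(** [w i] is [v i] composed with a matrix [J i] into its large domain. [J i] is chosen together with
    [v i.+1], for all unit [y] of the domain of [v i.+1], so the estimate persists when [y] is later
    restricted to the image of [J i.+1]. *)
Theorem exists_chain (n : nat -> nat) (eta : R) : 0 < eta ->
  exists w : forall i, 'I_(n i).+1 -> X, (forall i, near_isom eta (w i)) /\
    forall i s x x' y y', 0 <= s <= 1 ->
      nrm x = 1 -> nrm x' = 1 -> nrm y = 1 -> nrm y' = 1 ->
      `| `|mix s (w i) (w i.+1) x y| - `|mix s (w i) (w i.+1) x' y'| | <= eta.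
Proof.
move=> eta0; pose e := Num.min (eta / 40) (2^-1).
have e0 : 0 < e by rewrite lt_min divr_gt0//= invr_gt0.
have [ee e2] : e <= eta / 40 /\ e <= 2^-1 by split; rewrite ge_min lexx ?orbT.
have e1 : e <= 1 by lra.
pose N := Num.truncn e^-1.
have Ne : N.+1%:R^-1 <= e.
  by rewrite -[leRHS]invrK lef_pV2 ?posrE ?invr_gt0// ?ltr0n// ltW// truncnS_gt.
have HL i : {L | milman_dim (n i) N.+2 e L} by apply: cid; exact: milman.
pose L i := sval (HL i).
pose T i := {v : 'I_(L i).+1 -> X | near_isom e v}.
pose P i (v : 'I_(L i).+1 -> X) (v' : 'I_(L i.+1).+1 -> X) :=
  exists J : 'I_(L i).+1 -> 'I_(n i).+1 -> R,
    (forall a, `|nrm (rowmap J a) - nrm a| <= e * nrm a) /\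
    (forall s x x' y y', 0 <= s <= 1 ->
      nrm x = 1 -> nrm x' = 1 -> nrm y = 1 -> nrm y' = 1 ->
      `| `|mix s v v' (rowmap J x) y| - `|mix s v v' (rowmap J x') y'| | <= 31 * e).
have nxt i (t : T i) : {t' : T i.+1 | P i (sval t) (sval t')}.
  apply: cid; have [v' [v'I Pv']] := chain_step (L i.+1) e0 e2 Ne (svalP (HL i)) (svalP t).
  by exists (exist _ v' v'I).
have t0 : T 0%N by apply: cid; exact: dvoretzky.
pose st := nat_rect T t0 (fun i t => sval (nxt i t)).
have stP i : P i (sval (st i)) (sval (st i.+1)) by exact: (svalP (nxt i (st i))).
pose v i := sval (st i); have vI i : near_isom e (v i) := svalP (st i).
have /all_sig[J JP] i := cid (stP i).
have JN i a : `|nrm (rowmap (J i) a) - nrm a| <= e * nrm a := (JP i).1 a.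
exists (fun i => lcomp (v i) (J i)); split=> [i a|i s x x' y y' s01 x1 x'1 y1 y'1].
  rewrite lc_lcomp; have h1 := vI i (rowmap (J i) a); have h2 := JN i a.
  have h3 : nrm (rowmap (J i) a) <= 2 * nrm a.
    by have := ler_wpM2r (nrm_ge0 a) e1; move: h2; rewrite ler_norml; lra.
  have h4 := ler_wpM2l (ltW e0) h3.
  have h5 := ler_wpM2r (nrm_ge0 a) ee.
  move: h1 h2; rewrite !ler_norml; have := mulr_ge0 (ltW e0) (nrm_ge0 a); lra.
have mixE a b : mix s (lcomp (v i) (J i)) (lcomp (v i.+1) (J i.+1)) a b =
    mix s (v i) (v i.+1) (rowmap (J i) a) (rowmap (J i.+1) b).
  by rewrite /mix !lc_lcomp.
rewrite !mixE.
have unitJ b : nrm b = 1 -> exists2 b1, nrm b1 = 1 &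
    forall a, `| `|mix s (v i) (v i.+1) a (rowmap (J i.+1) b)| -
                 `|mix s (v i) (v i.+1) a b1| | <= 2 * e.
  move=> b1; have [|b2 b21 bb2] := @near_unit _ e (rowmap (J i.+1) b) e2.
    by have := JN i.+1 b; rewrite b1 mulr1.
  exists b2 => // a; apply: le_trans (norm_mixB _ _ _ _ _ _ s01) _.
  rewrite subrr lc0 normr0 add0r; apply: le_trans (near_isom_le _ e1 (vI i.+1)) _.
  by rewrite ler_wpM2l.
have [b b1 hb] := unitJ y y1; have [b' b'1 hb'] := unitJ y' y'1.
have := (JP i).2 s x x' b b' s01 x1 x'1 b1 b'1; rewrite -/(v i) -/(v i.+1).
have := hb (rowmap (J i) x); have := hb' (rowmap (J i) x').
rewrite !ler_norml; lra.
Qed.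

End Chains.

(** * Truncations of square summable sequences *)

Section Truncations.
Variable R : realType.
Implicit Types x y : ell2 R.

Definition trunc_ell2 k x : 'I_k -> R := fun i => ell2_seq x i.
Arguments trunc_ell2 : clear implicits.

Lemma trunc_ell2B k x y : trunc_ell2 k (x - y) = trunc_ell2 k x - trunc_ell2 k y.
Proof. by []. Qed.

Lemma sqr_nrm_trunc k x : nrm (trunc_ell2 k x) ^+ 2 = square_series x k.
Proof.
rewrite sqr_nrm /square_series /series /= big_mkord.
by apply: eq_bigr => i _; rewrite expr2.
Qed.

Lemma nrm_trunc_le k x : nrm (trunc_ell2 k x) <= `|x|.
Proof.
rewrite -(@ler_pXn2r _ 2)// ?nnegrE ?nrm_ge0// sqr_nrm_trunc.
rewrite -[`|x|]/(ell2_norm x) sqr_ell2_norm.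
exact/square_series_le_lim/ell2_cvg.
Qed.

Lemma nrm_trunc_ge (e : R) x : 0 < e -> e <= 1 ->
  exists k0, forall k, (k0 <= k)%N -> (1 - e) * `|x| <= nrm (trunc_ell2 k x).
Proof.
move=> e0 e1; have [->|x0] := eqVneq x 0.
  by exists 0%N => k _; rewrite normr0 mulr0 nrm_ge0.
have xp : 0 < `|x| by rewrite normr_gt0.
have lt1 : ((1 - e) * `|x|) ^+ 2 < limn (square_series x).
  rewrite -sqr_ell2_norm -[ell2_norm x]/(`|x|) exprMn gtr_pMl ?exprn_gt0//.
  by rewrite expr_lt1//; lra.
have [k0 _ hk] := cvgr_ge _ (ell2_cvg x) _ lt1.
exists k0 => k /hk; rewrite /= -sqr_nrm_trunc.
by rewrite ler_pXn2r// ?nnegrE ?nrm_ge0// mulr_ge0// subr_ge0.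
Qed.

End Truncations.

Arguments trunc_ell2 {R} k x _.

(** * A Lipschitz path of linear maps through the chain *)

Section Gluing.
Variables (R : realType) (X : normedModType R) (n : nat -> nat) (eta : R).
Variable w : forall i, 'I_(n i).+1 -> X.
Arguments w : clear implicits.
Hypotheses (eta0 : 0 < eta) (eta4 : eta <= 4^-1).
Hypothesis wI : forall i, near_isom eta (w i).
Hypothesis wmix : forall i s x x' y y', 0 <= s <= 1 ->
  nrm x = 1 -> nrm x' = 1 -> nrm y = 1 -> nrm y' = 1 ->
  `| `|mix s (w i) (w i.+1) x y| - `|mix s (w i) (w i.+1) x' y'| | <= eta.
Implicit Types (x y : ell2 R) (s t : R) (i : nat).
Arguments wI i a : clear implicits.
Arguments wmix i {s x x' y y'} _ _ _ _ _.

Definition mix_ell2 i s x : X :=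
  mix s (w i) (w i.+1) (trunc_ell2 (n i).+1 x) (trunc_ell2 (n i.+1).+1 x).

(** The normalising factor N_i(s): the norm of the mixture at any pair of unit vectors, up to [eta],
    read off at one pair. *)
Definition mix_scale i s : R :=
  `|mix s (w i) (w i.+1) (unitv ord0) (unitv ord0)|.

Definition bridge i s x : X := (mix_scale i s)^-1 *: mix_ell2 i s x.

Let eta1 : eta <= 1. Proof. by have := eta4; lra. Qed.

Lemma norm_lc_trunc i x : `|lc (w i) (trunc_ell2 (n i).+1 x)| <= 2 * `|x|.
Proof.
apply: le_trans (near_isom_le _ eta1 (wI i)) _.
by rewrite ler_pM2l// nrm_trunc_le.
Qed.

Lemma mix_ell2B i s x y : mix_ell2 i s (x - y) = mix_ell2 i s x - mix_ell2 i s y.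
Proof. by rewrite /mix_ell2 /mix !trunc_ell2B !lcB !scalerBr addrACA opprD. Qed.

Lemma bridgeB i s x y : bridge i s (x - y) = bridge i s x - bridge i s y.
Proof. by rewrite /bridge mix_ell2B scalerBr. Qed.

Lemma norm_mix_ell2 i s x : 0 <= s <= 1 -> `|mix_ell2 i s x| <= 4 * `|x|.
Proof.
move=> /andP[s0 s1]; apply: le_trans (ler_normD _ _) _.
rewrite !normrZ !ger0_norm ?subr_ge0//.
have h1 := norm_lc_trunc i x; have h2 := norm_lc_trunc i.+1 x.
have h3 : (1 - s) * `|lc (w i) (trunc_ell2 (n i).+1 x)| <= 2 * `|x|.
  by apply: le_trans h1; rewrite ler_piMl//; lra.
have h4 : s * `|lc (w i.+1) (trunc_ell2 (n i.+1).+1 x)| <= 2 * `|x|.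
  by apply: le_trans h2; rewrite ler_piMl//; lra.
lra.
Qed.

(* [y] and [- y] give almost the same norm, so [mix_scale] is almost at least
   half the norm of [2 (1 - s) w i] and of [2 s w i.+1]. *)
Lemma mix_scale_ge i s : 0 <= s <= 1 -> 4^-1 <= mix_scale i s.
Proof.
move=> s01; have /andP[s0 s1] := s01.
have nu1 k : nrm (unitv ord0 : 'I_k.+1 -> R) = 1 by exact: nrm_unitv.
have := wmix i s01 (nu1 (n i)) (nu1 (n i)) (nu1 (n i.+1)) (etrans (nrmN _) (nu1 (n i.+1))).
rewrite /mix_scale /mix lcN scalerN.
set a := (1 - s) *: _; set b := s *: _ => hab.
have ha : (1 - s) * (1 - eta) <= `|a|.
  rewrite normrZ ger0_norm ?subr_ge0// ler_wpM2l ?subr_ge0//.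
  by have := wI i (unitv ord0); rewrite nu1 ler_norml; lra.
have hb : s * (1 - eta) <= `|b|.
  rewrite normrZ ger0_norm// ler_wpM2l//.
  by have := wI i.+1 (unitv ord0); rewrite nu1 ler_norml; lra.
have h1 : `|a| + `|a| <= `|a + b| + `|a - b|.
  have -> : `|a| + `|a| = `|(a + b) + (a - b)|.
    by rewrite addrACA subrr addr0 -mulr2n normrMn mulr2n.
  exact: ler_normD.
have h2 : `|b| + `|b| <= `|a + b| + `|a - b|.
  have -> : `|b| + `|b| = `|(a + b) - (a - b)|.
    by rewrite opprB [a + b + _]addrC addrA subrK -mulr2n normrMn mulr2n.
  exact: ler_normB.
(* Adding [h1] and [h2] and using [hab] gives 1 - eta <= 2 |a + b| + eta, so |a + b| is at least 1/2
   - eta. *)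
move: hab; rewrite ler_norml; have := eta4; have := eta0; nra.
Qed.

(** After division by the norm of [x], both truncations are within [eta] of unit vectors, so the
    mixture has norm within [5 * eta] of [mix_scale], which is at least 1/4. *)
Lemma norm_bridge_near i s x : 0 <= s <= 1 ->
    (1 - eta) * `|x| <= nrm (trunc_ell2 (n i).+1 x) ->
    (1 - eta) * `|x| <= nrm (trunc_ell2 (n i.+1).+1 x) ->
  `| `|bridge i s x| - `|x| | <= 20 * eta * `|x|.
Proof.
move=> s01 ha hb; have [->|x0] := eqVneq x 0.
  have -> : bridge i s 0 = 0 by have := bridgeB i s 0 0; rewrite !subrr.
  by rewrite !normr0 mulr0 subrr normr0.
set r := `|x|; have r0 : 0 < r by rewrite normr_gt0.
have scale k (a : 'I_k -> R) : nrm a <= r -> (1 - eta) * r <= nrm a ->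
    `|nrm (r^-1 *: a) - 1| <= eta.
  move=> h1 h2; rewrite nrmZ [`|r^-1|]ger0_norm ?invr_ge0 ?(ltW r0)//.
  rewrite ler_norml mulrC lerBlDr lerBrDr ler_pdivrMr// ler_pdivlMr//.
  have := mulr_gt0 eta0 r0; lra.
have eta2 : eta <= 2^-1 by have := eta4; lra.
have [a1 a11 ha1] := near_unit eta2 (scale _ _ (nrm_trunc_le _ x) ha).
have [b1 b11 hb1] := near_unit eta2 (scale _ _ (nrm_trunc_le _ x) hb).
set a := trunc_ell2 (n i).+1 x in ha1; set b := trunc_ell2 (n i.+1).+1 x in hb1.
have nu1 k : nrm (unitv ord0 : 'I_k.+1 -> R) = 1 by exact: nrm_unitv.
have h1 := wmix i s01 a11 (nu1 _) b11 (nu1 _); rewrite -/(mix_scale i s) in h1.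
have h2 := norm_mixB (w i) (w i.+1) (r^-1 *: a) a1 (r^-1 *: b) b1 s01.
have h3 := near_isom_le (r^-1 *: a - a1) eta1 (wI i).
have h4 := near_isom_le (r^-1 *: b - b1) eta1 (wI i.+1).
have m0 := mix_scale_ge i s01; have mp : 0 < mix_scale i s by lra.
have h5 : `| `|mix s (w i) (w i.+1) (r^-1 *: a) (r^-1 *: b)| - mix_scale i s|
    <= 5 * eta.
  by move: h1 h2; rewrite !ler_norml; lra.
have e1 : mix s (w i) (w i.+1) (r^-1 *: a) (r^-1 *: b) = r^-1 *: mix_ell2 i s x.
  by rewrite /mix_ell2 /mix !lcZ scalerDr !scalerA ![r^-1 * _]mulrC.
rewrite e1 normrZ [`|r^-1|]ger0_norm ?invr_ge0 ?(ltW r0)// in h5.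
rewrite /bridge normrZ [`|_^-1|]ger0_norm ?invr_ge0 ?(ltW mp)//.
set W := `|mix_ell2 i s x| in h5 *.
have -> : (mix_scale i s)^-1 * W - r =
    (mix_scale i s)^-1 * (r * (r^-1 * W - mix_scale i s)).
  by field; rewrite !gt_eqF.
rewrite normrM ger0_norm ?invr_ge0 ?(ltW mp)// normrM (ger0_norm (ltW r0)).
rewrite ler_pdivrMl//; have h6 := ler_wpM2l (ltW r0) h5.
apply: le_trans h6 _; have := mulr_ge0 (ltW eta0) (ltW r0) => er.
have := ler_wpM2r er m0; lra.
Qed.

(** Product rule, with inverse scales at most 4: the variation of the mixture contributes 4 * 4 and
    that of the inverse scale 4 * 4 * 4 * 4, in total 272. *)
Lemma bridge_lip i s t x : 0 <= s <= 1 -> 0 <= t <= 1 ->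
  `|bridge i s x - bridge i t x| <= 272 * `|s - t| * `|x|.
Proof.
move=> s01 t01.
have ms := mix_scale_ge i s01; have mt := mix_scale_ge i t01.
have ms0 : 0 < mix_scale i s by lra. have mt0 : 0 < mix_scale i t by lra.
have nu1 k : nrm (unitv ord0 : 'I_k.+1 -> R) = 1 by exact: nrm_unitv.
have hm : `|mix_scale i s - mix_scale i t| <= `|s - t| * 4.
  apply: le_trans (norm_mix_weight _ _ _ _ _ _) _; apply: ler_wpM2l => //.
  have := near_isom_le (unitv ord0) eta1 (wI i).
  have := near_isom_le (unitv ord0) eta1 (wI i.+1).
  by rewrite !nu1; lra.
have hW : `|mix_ell2 i s x - mix_ell2 i t x| <= `|s - t| * (4 * `|x|).
  rewrite /mix_ell2 /mix opprD addrACA -!scalerBl.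
  apply: le_trans (ler_normD _ _) _; rewrite !normrZ.
  have -> : 1 - s - (1 - t) = - (s - t) by ring.
  rewrite normrN -mulrDr ler_wpM2l//.
  by have := norm_lc_trunc i x; have := norm_lc_trunc i.+1 x; lra.
have inv4 (m : R) : 4^-1 <= m -> 0 <= m^-1 <= 4.
  move=> h; have m0 : 0 < m by lra.
  rewrite invr_ge0 (ltW m0) /= -[m^-1]mul1r ler_pdivrMr//; lra.
have /andP[is0 is4] := inv4 _ ms; have /andP[it0 it4] := inv4 _ mt.
have -> : bridge i s x - bridge i t x =
    (mix_scale i s)^-1 *: (mix_ell2 i s x - mix_ell2 i t x) +
    ((mix_scale i s)^-1 - (mix_scale i t)^-1) *: mix_ell2 i t x.
  by rewrite /bridge scalerBr scalerBl addrA subrK.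
apply: le_trans (ler_normD _ _) _; rewrite !normrZ (ger0_norm is0).
have -> : (mix_scale i s)^-1 - (mix_scale i t)^-1 =
    (mix_scale i s)^-1 * (mix_scale i t)^-1 * (mix_scale i t - mix_scale i s).
  by field; rewrite !gt_eqF.
rewrite !normrM (ger0_norm is0) (ger0_norm it0) [`|_ - mix_scale i s|]distrC.
have hx := normr_ge0 x; have hst := normr_ge0 (s - t).
have g1 : (mix_scale i s)^-1 * `|mix_ell2 i s x - mix_ell2 i t x| <=
    4 * (`|s - t| * (4 * `|x|)) by apply: ler_pM.
have g2 : (mix_scale i s)^-1 * (mix_scale i t)^-1 *
    `|mix_scale i s - mix_scale i t| * `|mix_ell2 i t x| <=
    4 * 4 * (`|s - t| * 4) * (4 * `|x|).
  apply: ler_pM => //; [by rewrite !mulr_ge0| |exact: norm_mix_ell2].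
  by apply: ler_pM => //; [exact: mulr_ge0|exact: ler_pM].
have -> : 272 * `|s - t| * `|x| = 4 * (`|s - t| * (4 * `|x|)) +
    4 * 4 * (`|s - t| * 4) * (4 * `|x|) by ring.
exact: lerD.
Qed.

(** Consecutive bridges agree at integer times. *)
Lemma bridge1 i x : bridge i 1 x = bridge i.+1 0 x.
Proof.
by rewrite /bridge /mix_scale /mix_ell2 /mix subrr subr0 !scale0r !scale1r !addr0 !add0r.
Qed.

Definition glued t x : X := bridge (Num.truncn t) (t - (Num.truncn t)%:R) x.

Lemma truncn_frac t : 0 <= t -> 0 <= t - (Num.truncn t)%:R <= 1.
Proof. by move=> /truncn_itv /andP[]; rewrite -natr1; lra. Qed.

Lemma gluedB t x y : glued t (x - y) = glued t x - glued t y.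
Proof. exact: bridgeB. Qed.

Lemma glued_nat i x : glued i%:R x = bridge i 0 x.
Proof. by rewrite /glued natrK subrr. Qed.

(** The interval is cut at the integers it crosses, by induction on their number. *)
Lemma glued_lip t t' x : 0 <= t -> t <= t' ->
  `|glued t x - glued t' x| <= 272 * (t' - t) * `|x|.
Proof.
move=> t0 tt'; have t'0 := le_trans t0 tt'.
have [m hm] : exists m, Num.truncn t' = (Num.truncn t + m)%N.
  by exists (Num.truncn t' - Num.truncn t)%N; rewrite subnKC// le_truncn.
elim: m t t0 tt' hm => [|m IH] t t0 tt' hm.
  rewrite addn0 in hm; rewrite /glued hm.
  have := bridge_lip (Num.truncn t) x (truncn_frac t0) (truncn_frac t'0).
  rewrite hm; have -> : t - (Num.truncn t)%:R - (t' - (Num.truncn t)%:R) = - (t' - t).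
    by ring.
  by rewrite normrN ger0_norm ?subr_ge0.
set i := Num.truncn t in hm.
have /andP[ti ti1] := truncn_itv t0; rewrite -/i in ti ti1.
have it' : i.+1%:R <= t' by rewrite -truncn_ge_nat// hm addnS ltnS leq_addr.
have h1 : `|glued i.+1%:R x - glued t' x| <= 272 * (t' - i.+1%:R) * `|x|.
  by apply: IH => //; rewrite natrK hm addnS addSn.
have h2 : `|glued t x - glued i.+1%:R x| <= 272 * (i.+1%:R - t) * `|x|.
  rewrite glued_nat -bridge1 /glued -/i.
  have := bridge_lip i x (truncn_frac t0) (_ : 0 <= 1 <= 1); rewrite -/i.
  move=> /(_ _); rewrite ler01 lexx => /(_ isT).
  have -> : t - i%:R - 1 = - (i.+1%:R - t) by rewrite -natr1; ring.
  by rewrite normrN ger0_norm// subr_ge0 ltW.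
have -> : glued t x - glued t' x =
    (glued t x - glued i.+1%:R x) + (glued i.+1%:R x - glued t' x) by rewrite addrA subrK.
apply: le_trans (ler_normD _ _) _; lra.
Qed.

End Gluing.

(** * Distortion of almost isometric maps *)

Section Distortion.
Variables (R : realType) (V W : normedModType R) (M : set V) (F : V -> W).

Lemma lipschitz_constant_ge0 : (0 <= lipschitz_constant M F)%E.
Proof. by apply: le_ereal_inf_tmp => _ [k [k0 _] <-]; rewrite lee_fin. Qed.

Lemma lipschitz_constant_le (k : R) : 0 <= k ->
  (forall u v, M u -> M v -> `|F u - F v| <= k * `|u - v|) ->
  (lipschitz_constant M F <= k%:E)%E.
Proof.
move=> k0 h; apply: ereal_inf_lbound; exists k => //; split=> //.
by move=> [u v] [/= Mu Mv]; exact: h.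
Qed.

End Distortion.

(** The Lipschitz constants of [F] and of its inverse are at most 1 + t and 1/(1 - t); the lower
    bound also gives the injectivity that makes [pinv] invert [F] on [M]. *)
Lemma C_bilipschitz_near (R : realType) (V W : normedModType R) (M : set V)
    (F : V -> W) (t : R) : 0 < t -> t < 1 ->
    (forall u v, M u -> M v -> `| `|F u - F v| - `|u - v| | <= t * `|u - v|) ->
  C_bilipschitz ((1 + t) / (1 - t)) M F.
Proof.
move=> t0 t1 h; have t1' : 0 < 1 - t by lra.
have hb u v : M u -> M v -> (1 - t) * `|u - v| <= `|F u - F v| /\
    `|F u - F v| <= (1 + t) * `|u - v|.
  by move=> Mu Mv; have := h u v Mu Mv; rewrite ler_norml; lra.
split; first by exists (1 - t), (1 + t); split=> //; lra.
have Finj : {in M &, injective F}.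
  move=> u v; rewrite !inE => Mu Mv Fuv; have [+ _] := hb u v Mu Mv.
  rewrite Fuv subrr normr0 pmulr_rle0// normr_le0 subr_eq0; exact: eqP.
rewrite /distortion EFinM; apply: lee_pmul; rewrite ?lipschitz_constant_ge0//.
  by apply: lipschitz_constant_le => [|u v Mu Mv]; [lra|exact: (hb u v Mu Mv).2].
apply: lipschitz_constant_le => [|_ _ [u Mu <-] [v Mv <-]].
  by rewrite invr_ge0 ltW.
rewrite !pinvKV ?inE//; rewrite ler_pdivlMl//; exact: (hb u v Mu Mv).1.
Qed.

(** * The logarithmic time and the embedding *)

Section Embedding.
Variable R : realType.

Definition log_scale (kappa : R) (x : ell2 R) : R := kappa * ln (1 + `|x|).

Lemma log_scale_ge0 kappa x : 0 <= kappa -> 0 <= log_scale kappa x.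
Proof. by move=> k0; rewrite mulr_ge0// ln_ge0// lerDl. Qed.

(** With [d] the increment of the norm divided by [1 + |x|], the difference of logarithms is ln (1 +
    d) <= d, and [d * |x|] is at most the increment. *)
Lemma log_scale_lip kappa (x y : ell2 R) : 0 <= kappa -> `|x| <= `|y| ->
  log_scale kappa x <= log_scale kappa y /\
  (log_scale kappa y - log_scale kappa x) * `|x| <= kappa * `|y - x|.
Proof.
move=> k0 xy; have x0 := normr_ge0 x.
have px : 0 < 1 + `|x| by lra. have py : 0 < 1 + `|y| by lra.
have lexy : ln (1 + `|x|) <= ln (1 + `|y|) by rewrite ler_ln ?posrE//; lra.
split; first by rewrite ler_wpM2l.
rewrite /log_scale -mulrBr -mulrA ler_wpM2l//.
apply: (@le_trans _ _ (`|y| - `|x|)); last first.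
  by have := lerB_dist y x.
rewrite -ln_div ?posrE//.
have -> : (1 + `|y|) / (1 + `|x|) = 1 + (`|y| - `|x|) / (1 + `|x|).
  by field; rewrite gt_eqF.
set d := (`|y| - `|x|) / (1 + `|x|).
have d0 : 0 <= d by rewrite divr_ge0 ?subr_ge0// ltW.
have h1 : ln (1 + d) <= d by apply: le_ln1Dx; lra.
apply: (@le_trans _ _ (d * (1 + `|x|))); last by rewrite divfK// gt_eqF.
have := ler_wpM2r x0 h1; lra.
Qed.

Lemma finite_log_scale kappa (M : set (ell2 R)) (r : R) :
  0 < kappa -> locally_finite M -> finite_set [set x | M x /\ log_scale kappa x < r].
Proof.
move=> k0 lfM; have [[x0 Mx0]|nM] := pselect (M !=set0); last first.
  by rewrite (_ : [set x | _] = set0)//; apply/seteqP; split=> // x [Mx _]; case: nM; exists x.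
(* [locally_finite] concerns balls centred in [M], so the ball about the origin is enclosed in one
   about [x0]. *)
apply: sub_finite_set (lfM x0 (`|x0| + expR (r / kappa)) Mx0) => x [Mx xr].
split=> //; rewrite -ball_normE /=; apply: le_lt_trans (ler_normB _ _) _.
rewrite ltrD2l; apply: (@lt_trans _ _ (1 + `|x|)); first by rewrite ltrDr.
have px : 0 < 1 + `|x| by rewrite ltr_wpDr.
by rewrite -[ltLHS]lnK ?posrE// ltr_expR ltr_pdivlMr// mulrC.
Qed.

Lemma exists_trunc_dim (eta : R) (S : set (ell2 R)) : 0 < eta -> eta <= 1 ->
  finite_set S -> exists k, forall k' u v, (k <= k')%N -> S u -> S v ->
    (1 - eta) * `|u - v| <= nrm (trunc_ell2 k' (u - v)).
Proof.
move=> e0 e1 /finite_seqP[s ->].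
have /all_sig[K KP] u := cid (nrm_trunc_ge u e0 e1).
exists (\max_(u <- s) \max_(v <- s) K (u - v)%R)%N => k' u v kk' us vs.
apply: KP; apply: leq_trans kk'.
apply: leq_trans
  (@leq_bigmax_seq _ _ xpredT (fun u => \max_(v <- s) K (u - v)%R)%N u us isT).
exact: (@leq_bigmax_seq _ _ xpredT (fun v => K (u - v)) v vs isT).
Qed.

End Embedding.

Theorem theorem1p2 (R : realType) (eps : R) (M : set (ell2 R))
    (X : completeNormedModType R) :
  0 < eps -> locally_finite M -> infinite_dimensional X ->
  exists F : ell2 R -> X, C_bilipschitz (1 + eps) M F.
Proof.
move=> eps0 lfM infX.
(* The solution of (1 + t) / (1 - t) = 1 + eps. *)
pose t := eps / (2 + eps); have p2 : 0 < 2 + eps by lra.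
have tE : t * (2 + eps) = eps by rewrite divfK// gt_eqF.
have t0 : 0 < t by rewrite divr_gt0.
have t1 : t < 1 by rewrite ltr_pdivrMr//; lra.
have -> : 1 + eps = (1 + t) / (1 - t) by rewrite /t; field; rewrite !gt_eqF//; lra.
(* The bridge error [20 * eta] and the gluing error [272 * kappa] are each at most [t / 2]. *)
pose eta := Num.min (t / 40) 4^-1.
have eta0 : 0 < eta by rewrite lt_min divr_gt0//= invr_gt0.
have [etat eta4] : eta <= t / 40 /\ eta <= 4^-1 by split; rewrite ge_min lexx ?orbT.
have eta1 : eta <= 1 by lra.
pose kappa := t / 544; have kappa0 : 0 < kappa by rewrite divr_gt0 ?ltr0n.
(* The points of time less than i + 1. If [v] has its time in [i, i + 1) and [u] is no later, both
   belong to [S i] and [S i.+1], so the two truncations that [glued] uses at the time of [v] almost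
   preserve the norm of [v - u]. *)
pose S i := [set x | M x /\ log_scale kappa x < i.+1%:R].
have /all_sig[n nP] i := cid (exists_trunc_dim eta0 eta1 (finite_log_scale i.+1%:R kappa0 lfM)).
have [w [wI wmix]] := exists_chain infX n eta0.
pose F (x : ell2 R) : X := glued w (log_scale kappa x) x.
exists F; apply: C_bilipschitz_near => //.
have key u v : M u -> M v -> `|u| <= `|v| ->
    `| `|F v - F u| - `|v - u| | <= t * `|v - u|.
  move=> Mu Mv uv; have [tuv tlip] := log_scale_lip (ltW kappa0) uv.
  set tu := log_scale kappa u in tuv tlip; set tv := log_scale kappa v in tuv tlip.
  have tu0 : 0 <= tu := log_scale_ge0 u (ltW kappa0).
  have tv0 : 0 <= tv := le_trans tu0 tuv.
  have near : `| `|glued w tv (v - u)| - `|v - u| | <= 20 * eta * `|v - u|.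
    have tvi := truncnS_gt tv; set i := Num.truncn tv in tvi.
    have tvi1 : tv < i.+2%:R by apply: lt_trans tvi _; rewrite ltr_nat.
    apply: norm_bridge_near => //; first exact: truncn_frac.
      by apply: nP => //; split=> //; exact: le_lt_trans tvi.
    by apply: nP => //; split=> //; exact: le_lt_trans tvi1.
  have lip := glued_lip eta0 eta4 wI wmix u tu0 tuv.
  have {lip} lip : `|glued w tv u - glued w tu u| <= t / 2 * `|v - u|.
    rewrite distrC; apply: le_trans lip _; rewrite -mulrA.
    by rewrite /kappa in tlip; lra.
  have -> : F v - F u = glued w tv (v - u) + (glued w tv u - glued w tu u).
    by rewrite gluedB addrA subrK.
  have tri : `| `|glued w tv (v - u) + (glued w tv u - glued w tu u)| - `|glued w tv (v - u)| |
      <= `|glued w tv u - glued w tu u|.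
    apply: le_trans (ler_dist_dist _ _) _.
    by rewrite [glued w tv (v - u) + _]addrC addrK.
  have := ler_wpM2r (normr_ge0 (v - u)) etat.
  move: tri near; rewrite !ler_norml; lra.
move=> u v Mu Mv; have [uv|vu] := lerP `|u| `|v|.
  by rewrite [`|F u - F v|]distrC [`|u - v|]distrC; exact: key.
by apply: key => //; exact: ltW.
Qed.
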